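(* Let $m\ge 0$ be an integer, let $G$ and $H$ be groups of type $FP_m$, and let $X$ be a $G$-set such that for all $1\le i\le m$ the group $G$ acts diagonally on $X^i$ with finitely many orbits and such that the stabilizer in $G$ of every element of $X^i$ is of type $FP_{m-i}$. Then the permutational wreath product $\Gamma=H\wr_X G$ has type $FP_m$.
   Context: A group $G$ is of type $FP_m$ if the trivial $\mathbb{Z}G$-module $\mathbb{Z}$ has a projective resolution whose projectives are finitely generated in all dimensions $\le m$. For a (left) $G$-set $X$, the permutational wreath product $H\wr_X G$ is the semidirect product $H^{(X)}\rtimes G$, where $H^{(X)}$ is the direct sum of $|X|$ copies of $H$ and $G$ acts on $H^{(X)}$ by permuting the summands according to its action on $X$. *)

(* Defs.v *)
From HB Require Import structures.
From mathcomp Require Import all_boot all_order all_algebra.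
From mathcomp Require Import finmap.
From mathcomp Require Import boolp classical_sets functions cardinality.
From mathcomp.multinomials Require Import monalg.

Set Implicit Arguments.
Unset Strict Implicit.
Unset Printing Implicit Defensive.

Import GRing.Theory.
Local Open Scope ring_scope.

(* The additive group is the library's free abelian group on G. The library's
   own product on {malg int[K]} asks that the monoid K have no unit other than
   1, so the convolution product is redefined here. *)
Definition group_ring (G : groupType) : Type := {malg int[G]}.

HB.instance Definition _ (G : groupType) := GRing.Zmodule.on (group_ring G).

Section GroupRing.
Context (G : groupType).
Local Open Scope fset_scope.
Local Open Scope ring_scope.
Implicit Types (x y z : group_ring G) (k : G) (d : {fset G}).

Definition grmul x y : group_ring G :=
  \sum_(k1 <- msupp x) \sum_(k2 <- msupp y) << x@_k1 * y@_k2 *g (k1 * k2)%g >>.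

Definition grone : group_ring G := << 1%g >>.

Lemma grmulEw d1 d2 x y : msupp x `<=` d1 -> msupp y `<=` d2 ->
  grmul x y =
  \sum_(k1 <- d1) \sum_(k2 <- d2) << x@_k1 * y@_k2 *g (k1 * k2)%g >>.
Proof.
move=> le1 le2; rewrite /grmul (big_fset_incl _ le1) /=.
  apply: eq_bigr => k1 _; apply: big_fset_incl => // k _ /mcoeff_outdom ->.
  by rewrite mulr0 monalgU0.
move=> k _ /mcoeff_outdom xk.
by rewrite big1 // => k' _; rewrite xk mul0r monalgU0.
Qed.

Lemma grmulDl : left_distributive grmul +%R.
Proof.
move=> x y z.
rewrite (grmulEw (msuppD_le x y) (fsubset_refl _)).
rewrite (grmulEw (fsubsetUl (msupp x) (msupp y)) (fsubset_refl _)).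
rewrite (grmulEw (fsubsetUr (msupp x) (msupp y)) (fsubset_refl _)).
rewrite -big_split /=; apply: eq_bigr => k1 _.
rewrite -big_split /=; apply: eq_bigr => k2 _.
by rewrite mcoeffD mulrDl monalgUD.
Qed.

Lemma grmulDr : right_distributive grmul +%R.
Proof.
move=> z x y.
rewrite (grmulEw (fsubset_refl _) (msuppD_le x y)).
rewrite (grmulEw (fsubset_refl _) (fsubsetUl (msupp x) (msupp y))).
rewrite (grmulEw (fsubset_refl _) (fsubsetUr (msupp x) (msupp y))).
rewrite -big_split /=; apply: eq_bigr => k1 _.
rewrite -big_split /=; apply: eq_bigr => k2 _.
by rewrite mcoeffD mulrDr monalgUD.
Qed.

Lemma grmulUU c1 c2 k1 k2 :
  grmul << c1 *g k1 >> << c2 *g k2 >> = << c1 * c2 *g (k1 * k2)%g >>.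
Proof. by rewrite (grmulEw msuppU_le msuppU_le) !big_seq_fset1 !mcoeffUU. Qed.

Lemma grmul0l x : grmul 0 x = 0.
Proof. by apply: (addrI (grmul 0 x)); rewrite -grmulDl !addr0. Qed.

Lemma grmul0r x : grmul x 0 = 0.
Proof. by apply: (addrI (grmul x 0)); rewrite -grmulDr !addr0. Qed.

Lemma grmul_suml (I : Type) (s : seq I) (F : I -> group_ring G) x :
  grmul (\sum_(i <- s) F i) x = \sum_(i <- s) grmul (F i) x.
Proof. exact: (big_morph (grmul^~ x) (fun a b => grmulDl a b x) (grmul0l x)). Qed.

Lemma grmul_sumr (I : Type) (s : seq I) (F : I -> group_ring G) x :
  grmul x (\sum_(i <- s) F i) = \sum_(i <- s) grmul x (F i).
Proof. exact: (big_morph (grmul x) (fun a b => grmulDr x a b) (grmul0r x)). Qed.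

Lemma grmul1l : left_id grone grmul.
Proof.
move=> x; rewrite [in LHS](monalgE x) grmul_sumr [RHS]monalgE.
by apply: eq_bigr => k _; rewrite grmulUU mul1r mul1g.
Qed.

Lemma grmul1r : right_id grone grmul.
Proof.
move=> x; rewrite [in LHS](monalgE x) grmul_suml [RHS]monalgE.
by apply: eq_bigr => k _; rewrite grmulUU mulr1 mulg1.
Qed.

Lemma grmulA : associative grmul.
Proof.
move=> x y z; rewrite (monalgE x) grmul_suml (grmul_suml _ _ y) grmul_suml.
apply: eq_bigr => k1 _.
set a := << _ *g k1 >>; rewrite (monalgE y) grmul_suml (grmul_sumr _ _ a).
rewrite (grmul_sumr _ _ a) grmul_suml; apply: eq_bigr => k2 _.
set b := << _ *g k2 >>; rewrite (monalgE z) (grmul_sumr _ _ b).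
rewrite (grmul_sumr _ _ a) (grmul_sumr _ _ (grmul a b)).
by apply: eq_bigr => k3 _; rewrite !grmulUU mulrA mulgA.
Qed.

Lemma grone_neq0 : grone != 0.
Proof. by apply/eqP => /malgP/(_ 1%g)/eqP; rewrite mcoeffUU mcoeff0 oner_eq0. Qed.

HB.instance Definition _ := GRing.Zmodule_isNzRing.Build (group_ring G)
  grmulA grmul1l grmul1r grmulDl grmulDr grone_neq0.

Definition augmentation x : int := \sum_(k <- msupp x) x@_k.

Lemma augmentationEw d x : msupp x `<=` d -> augmentation x = \sum_(k <- d) x@_k.
Proof. by move=> le; apply: big_fset_incl => // k _ /mcoeff_outdom. Qed.

Lemma augmentationD : {morph augmentation : x y / x + y}.
Proof.
move=> x y; rewrite (augmentationEw (msuppD_le x y)).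
rewrite (augmentationEw (fsubsetUl (msupp x) (msupp y))).
rewrite (augmentationEw (fsubsetUr (msupp x) (msupp y))).
by rewrite -big_split; apply: eq_bigr => k _; rewrite mcoeffD.
Qed.

Lemma augmentationU c k : augmentation << c *g k >> = c.
Proof. by rewrite (augmentationEw msuppU_le) big_seq_fset1 mcoeffUU. Qed.

Lemma augmentation0 : augmentation 0 = 0.
Proof. by rewrite /augmentation msupp0 big_seq_fset0. Qed.

Lemma augmentation1 : augmentation 1 = 1.
Proof. exact: augmentationU. Qed.

Lemma augmentationM : {morph augmentation : x y / x * y}.
Proof.
move=> x y; rewrite [x * y]/(grmul x y) /grmul.
rewrite (big_morph _ augmentationD augmentation0) mulr_suml.
apply: eq_bigr => k1 _; rewrite (big_morph _ augmentationD augmentation0).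
by rewrite mulr_sumr; apply: eq_bigr => k2 _; rewrite augmentationU.
Qed.

End GroupRing.

Definition triv_module (G : groupType) : Type := int.

HB.instance Definition _ (G : groupType) := GRing.Zmodule.on (triv_module G).

Section TrivialModule.
Context (G : groupType).
Implicit Types (a b : group_ring G) (n : triv_module G).

(* Every g : G acts trivially; extended linearly to the group ring. *)
Definition triv_scale a n : triv_module G := augmentation a * (n : int).

Lemma triv_scaleA a b n : triv_scale a (triv_scale b n) = triv_scale (a * b) n.
Proof. by rewrite /triv_scale augmentationM mulrA. Qed.

Lemma triv_scale1 : left_id 1 triv_scale.
Proof. by move=> n; rewrite /triv_scale augmentation1 mul1r. Qed.

Lemma triv_scaleDr : right_distributive triv_scale +%R.
Proof. by move=> a n p; rewrite /triv_scale mulrDr. Qed.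

Lemma triv_scaleDl n : {morph triv_scale^~ n : a b / a + b}.
Proof. by move=> a b; rewrite /triv_scale augmentationD mulrDl. Qed.

HB.instance Definition _ := GRing.Zmodule_isLmodule.Build (group_ring G)
  (triv_module G) triv_scaleA triv_scale1 triv_scaleDr triv_scaleDl.

End TrivialModule.

Definition surj (A B : Type) (f : A -> B) : Prop := forall y, exists x, f x = y.

Definition projective (R : nzRingType) (P : lmodType R) : Prop :=
  forall (M N : lmodType R) (p : {linear M -> N}) (f : {linear P -> N}),
    surj p -> exists h : {linear P -> M}, forall x, p (h x) = f x.

Definition finitely_generated (R : nzRingType) (M : lmodType R) : Prop :=
  exists (n : nat) (e : 'I_n -> M),
    forall x, exists c : 'I_n -> R, x = \sum_i c i *: e i.

Definition exact_at (R : nzRingType) (A B C : lmodType R)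
    (f : {linear A -> B}) (g : {linear B -> C}) : Prop :=
  forall y, g y = 0 <-> exists x, f x = y.

Definition projective_resolution (R : nzRingType) (M : lmodType R)
    (P : nat -> lmodType R) (d : forall n, {linear P n.+1 -> P n})
    (e : {linear P 0%N -> M}) : Prop :=
  [/\ forall n, projective (P n),
      surj e,
      exact_at (d 0%N) e
    & forall n, exact_at (d n.+1) (d n)].

Definition type_FP (m : nat) (G : groupType) : Prop :=
  exists (P : nat -> lmodType (group_ring G))
         (d : forall n, {linear P n.+1 -> P n})
         (e : {linear P 0%N -> triv_module G}),
    projective_resolution d e /\
    forall n, (n <= m)%N -> finitely_generated (P n).

Record gset (G : groupType) (X : Type) := GSet {
  gact :> G -> X -> X;
  gact1 : forall x, gact 1%g x = x;
  gactM : forall g h x, gact (g * h)%g x = gact g (gact h x)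
}.

Section GSetTheory.
Context (G : groupType) (X : choiceType) (to : gset G X).

Definition gorbit (x : X) : set X := range (fun g => to g x).

Definition finitely_many_orbits : Prop := finite_set (range gorbit).

Definition stab_pred (x : X) : pred G := fun g => to g x == x.

Definition stabilizer (x : X) : Type := {g : G | stab_pred x g}.

Lemma stab_group_closed x : group_closed (stab_pred x).
Proof.
split=> [|g h]; rewrite /in_mem /= /stab_pred ?gact1 // => /eqP gx /eqP hx.
have hVx : to h^-1%g x = x by rewrite -{1}hx -gactM mulVg gact1.
by apply/eqP; rewrite gactM hVx gx.
Qed.

HB.instance Definition _ x := SubChoice.on (stabilizer x).
HB.instance Definition _ x := SubChoice_isSubGroup.Build G (stab_pred x)
  (stabilizer x) (stab_group_closed x).

Definition diag_act n (g : G) (t : n.-tuple X) : n.-tuple X :=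
  [tuple to g (tnth t i) | i < n].

Lemma diag_act1 n (t : n.-tuple X) : diag_act 1%g t = t.
Proof. by apply: eq_from_tnth => i; rewrite tnth_mktuple gact1. Qed.

Lemma diag_actM n g h (t : n.-tuple X) :
  diag_act (g * h)%g t = diag_act g (diag_act h t).
Proof. by apply: eq_from_tnth => i; rewrite !tnth_mktuple gactM. Qed.

Definition diagonal n : gset G (n.-tuple X) :=
  GSet (@diag_act1 n) (@diag_actM n).

End GSetTheory.

Record autact (G K : groupType) := AutAct {
  autact_gset :> gset G K;
  autactM : forall g, {morph autact_gset g : x y / (x * y)%g}
}.

Record sdprod (G K : groupType) (phi : autact G K) :=
  SDProd { sd_left : K; sd_right : G }.

Section SemidirectProduct.
Context (G K : groupType) (phi : autact G K).
Local Open Scope group_scope.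
Notation S := (sdprod phi).

Definition sd_pair (u : S) : K * G := (sd_left u, sd_right u).
Definition sd_unpair (v : K * G) : S := SDProd phi v.1 v.2.

Lemma sd_pairK : cancel sd_pair sd_unpair. Proof. by case. Qed.

HB.instance Definition _ := Choice.copy S (can_type sd_pairK).

Definition sd_mul (u v : S) : S :=
  SDProd phi (sd_left u * phi (sd_right u) (sd_left v))
             (sd_right u * sd_right v).
Definition sd_one : S := SDProd phi 1 1.
Definition sd_inv (u : S) : S :=
  SDProd phi (phi (sd_right u)^-1 (sd_left u)^-1) (sd_right u)^-1.

Lemma autact1 g : phi g 1 = 1.
Proof. by apply: (mulgI (phi g 1)); rewrite -autactM !mulg1. Qed.

Lemma sd_mulA : associative sd_mul.
Proof. by case=> a g [b h] [c k]; rewrite /sd_mul /= autactM gactM !mulgA. Qed.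

Lemma sd_mul1g : left_id sd_one sd_mul.
Proof. by case=> a g; rewrite /sd_mul /= gact1 !mul1g. Qed.

Lemma sd_mulg1 : right_id sd_one sd_mul.
Proof. by case=> a g; rewrite /sd_mul /= autact1 !mulg1. Qed.

Lemma sd_mulVg : left_inverse sd_one sd_inv sd_mul.
Proof. by case=> a g; rewrite /sd_mul /= -autactM !mulVg autact1. Qed.

Lemma sd_mulgV : right_inverse sd_one sd_inv sd_mul.
Proof. by case=> a g; rewrite /sd_mul /= -gactM !mulgV gact1 mulgV. Qed.

HB.instance Definition _ := isGroup.Build S
  sd_mulA sd_mul1g sd_mulg1 sd_mulVg sd_mulgV.

End SemidirectProduct.

Definition direct_sum (X : choiceType) (H : groupType) : Type :=
  {fsfun X -> H with 1%g}.

HB.instance Definition _ X H := Choice.on (direct_sum X H).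

Section DirectSum.
Context (X : choiceType) (H : groupType).
Local Open Scope fset_scope.
Local Open Scope group_scope.
Notation D := (direct_sum X H).

Definition ds_fun (u : D) : X -> H := fun_of_fsfun u.
Coercion ds_fun : direct_sum >-> Funclass.

Lemma dsP (u v : D) : u =1 v -> u = v.
Proof. by move=> uv; apply/fsfunP. Qed.

Lemma ds_out (u : D) x : x \notin finsupp u -> u x = 1.
Proof. exact: fsfun_dflt. Qed.

Definition ds_one : D := [fsfun].
Definition ds_inv (u : D) : D := [fsfun x in finsupp u => (u x)^-1].
Definition ds_mul (u v : D) : D :=
  [fsfun x in finsupp u `|` finsupp v => u x * v x].

Lemma ds_oneE x : ds_one x = 1. Proof. exact: fsfun0E. Qed.

Lemma ds_invE u x : ds_inv u x = (u x)^-1.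
Proof.
rewrite {1}/ds_fun fsfun_fun; case: ifPn => // /ds_out ->.
by rewrite invg1.
Qed.

Lemma ds_mulE u v x : ds_mul u v x = u x * v x.
Proof.
rewrite {1}/ds_fun fsfun_fun in_fsetU; case: ifPn => //.
by rewrite negb_or => /andP[/ds_out -> /ds_out ->]; rewrite mulg1.
Qed.

Lemma ds_mulA : associative ds_mul.
Proof. by move=> u v w; apply: dsP => x; rewrite !ds_mulE mulgA. Qed.

Lemma ds_mul1g : left_id ds_one ds_mul.
Proof. by move=> u; apply: dsP => x; rewrite !(ds_mulE, ds_oneE) mul1g. Qed.

Lemma ds_mulg1 : right_id ds_one ds_mul.
Proof. by move=> u; apply: dsP => x; rewrite !(ds_mulE, ds_oneE) mulg1. Qed.

Lemma ds_mulVg : left_inverse ds_one ds_inv ds_mul.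
Proof.
by move=> u; apply: dsP => x; rewrite !(ds_mulE, ds_invE, ds_oneE) mulVg.
Qed.

Lemma ds_mulgV : right_inverse ds_one ds_inv ds_mul.
Proof.
by move=> u; apply: dsP => x; rewrite !(ds_mulE, ds_invE, ds_oneE) mulgV.
Qed.

HB.instance Definition _ := isGroup.Build D
  ds_mulA ds_mul1g ds_mulg1 ds_mulVg ds_mulgV.

End DirectSum.

Section Wreath.
Context (H G : groupType) (X : choiceType) (to : gset G X).
Local Open Scope fset_scope.
Local Open Scope group_scope.
Notation D := (direct_sum X H).

(* The copy of H indexed by x is moved to the copy indexed by to g x, that is
   (g . u) x = u (g^-1 . x). *)
Definition ds_perm (g : G) (u : D) : D :=
  [fsfun x in [fset to g y | y in finsupp u] => u (to g^-1 x)].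

Lemma ds_permE g u x : ds_perm g u x = u (to g^-1 x).
Proof.
rewrite {1}/ds_fun fsfun_fun; case: ifPn => // xNim.
rewrite [RHS]ds_out //; apply: contraNN xNim => ux; apply/imfsetP.
by exists (to g^-1 x); rewrite //= -gactM mulgV gact1.
Qed.

Lemma ds_perm1 u : ds_perm 1 u = u.
Proof. by apply: dsP => x; rewrite ds_permE invg1 gact1. Qed.

Lemma ds_permM g h u : ds_perm (g * h) u = ds_perm g (ds_perm h u).
Proof. by apply: dsP => x; rewrite !ds_permE invgM gactM. Qed.

Lemma ds_perm_morph g : {morph ds_perm g : u v / (u * v)%g}.
Proof.
move=> u v; apply: dsP => x.
by rewrite !(ds_permE, ds_mulE).
Qed.

Definition ds_autact : autact G D :=
  @AutAct G D (GSet ds_perm1 ds_permM) ds_perm_morph.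

Definition wreath : groupType := sdprod ds_autact.

End Wreath.

Arguments wreath H {G X} to.

(* Main.v *)
From HB Require Import structures.
From mathcomp Require Import all_boot all_order all_algebra.
From mathcomp Require Import finmap.
From mathcomp Require Import boolp classical_sets cardinality.
From mathcomp.multinomials Require Import monalg.
Require Import Defs.

Set Implicit Arguments.
Unset Strict Implicit.
Unset Printing Implicit Defensive.

Import GRing.Theory.
Local Open Scope ring_scope.

(** Let A be the direct sum of copies of H indexed by X, and let W be the
    wreath product, the semidirect product of A by G. For x in X, resetting
    the x-coordinate of the elements of A to 1 induces an endomorphism p_x of
    Z[A]; these endomorphisms are idempotent and commute. For a tuple t of
    elements of X, put J_t = the set of the chains in Z[A] killed by p_x for
    every entry x of t. With I the augmentation ideal of Z[H], this is the
    tensor product of a copy of I for each element of X that occurs in t and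
    of copies of Z[H] for the others.

    The group W permutes X^i * A, and the sum C_i of the J_t over t in X^i is
    a W-submodule of Z[X^i * A] ([killed_chains]). Deleting entries of tuples
    gives a simplicial boundary C_(i+1) -> C_i, and the complex
      ... -> C_2 -> C_1 -> C_0 = Z[A] -> Z
    is exact, as for the nerve of a covering of the augmentation ideal of Z[A]
    by the J_x: for a cycle z, adding y in front of the tuples of z - p_y z
    gives a chain with boundary z - p_y z, and finitely many p_y together
    annihilate z ([boundary_exact], [coef_sum_exact]). Tuples with repeated
    entries are kept: the stabilizer of a tuple then fixes all its entries, so
    that no orientation characters occur, and the hypotheses of the theorem are
    about exactly these stabilizers. By dimension shifting ([fin_res_shift]),
    W has type FP_m once C_i has type FP_(m-i) for all i <= m.

    Both steps of the proof of this last fact are instances of one lemma,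
    [tens_aug_fin_res]. Suppose that H acts freely on the right on a set Y,
    commuting with a left action of W, and let B be a submodule of Z[Y] that
    is a direct summand for the right action. Then B is flat over Z[H], so
    tensoring a resolution of I by free modules with B gives a resolution of
    B (x) I by powers of B. Thus B (x) I, the kernel of B -> Z[Y/H], has the
    finiteness properties shared by B and I.
    - With the stabilizer L of a tuple t acting on the right on W, this shows
      that Z[W/L] = Z[W] / (Z[W] (x) I_L) has type FP_(m-i) if L does
      ([orbit_fin_res]). This module is the part of Z[X^i * A] over the orbit
      of t.
    - With H acting on the coordinate of A indexed by the l-th entry of the
      tuple, it gives one more of the conditions p_x z = 0 that define J_t
      ([chains_step]). It is applied once for each value of t, and H has type
      FP_m, so the type FP_(m-i) is preserved.
    Finitely many orbits are then put together ([chains_orbits]). *)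

(** * Additive maps on modules of formal sums *)

Section Additive.
Context (U V : zmodType) (f : U -> V) (fD : {morph f : x y / x + y}).

Fact addmap0 : f 0 = 0.
Proof. by apply: (addrI (f 0)); rewrite -fD !addr0. Qed.

Definition addmap : {additive U -> V} :=
  HB.pack f (GRing.isNmodMorphism.Build U V f (addmap0, fD)).

End Additive.

Section MalgLift.
Context (K : choiceType) (G V : zmodType).
Context (F : K -> {additive G -> V}).
Local Open Scope fset_scope.
Local Open Scope ring_scope.

Definition malg_lift (x : {malg G[K]}) : V := \sum_(k <- msupp x) F k x@_k.

Lemma malg_liftEw d x : msupp x `<=` d -> malg_lift x = \sum_(k <- d) F k x@_k.
Proof.
move=> le; apply: big_fset_incl => // k _ /mcoeff_outdom ->.
exact: raddf0.
Qed.

Lemma malg_liftD : {morph malg_lift : x y / x + y}.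
Proof.
move=> x y; rewrite (malg_liftEw (msuppD_le x y)).
rewrite (malg_liftEw (fsubsetUl (msupp x) (msupp y))).
rewrite (malg_liftEw (fsubsetUr (msupp x) (msupp y))).
by rewrite -big_split; apply: eq_bigr => k _; rewrite mcoeffD raddfD.
Qed.

Fact malg_lift0 : malg_lift 0 = 0.
Proof. by apply: (addrI (malg_lift 0)); rewrite -malg_liftD !addr0. Qed.

HB.instance Definition _ :=
  GRing.isNmodMorphism.Build {malg G[K]} V malg_lift (malg_lift0, malg_liftD).

Lemma malg_liftU c k : malg_lift << c *g k >> = F k c.
Proof. by rewrite (malg_liftEw msuppU_le) big_seq_fset1 mcoeffUU. Qed.

End MalgLift.

(** * Linear maps and submodules *)

Section LinearMaps.
Context (R : nzRingType).
Implicit Types U V W : lmodType R.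

(** This and [lcomp] fix one form for the linear maps built here, so that
    [linmapE] and [lcompE] unfold them one layer at a time: simplification
    would also unfold the inclusions below them. *)
Definition linmap U V (f : U -> V) (fl : linear f) : {linear U -> V} :=
  HB.pack f (GRing.isLinear.Build R U V *:%R f fl).

Lemma linmapE U V (f : U -> V) (fl : linear f) x : linmap fl x = f x.
Proof. by []. Qed.

Definition lcomp U V W (g : {linear V -> W}) (f : {linear U -> V}) :
  {linear U -> W} := g \o f.

Lemma lcompE U V W (g : {linear V -> W}) (f : {linear U -> V}) x :
  lcomp g f x = g (f x).
Proof. by []. Qed.

Record submodule V := Submodule {
  submod_mem :> V -> Prop;
  submod0 : submod_mem 0;
  submodP : forall a x y,
    submod_mem x -> submod_mem y -> submod_mem (a *: x + y)
}.

Definition submod_in V (S : submodule V) : {pred V} := fun x => `[< S x >].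

Fact submod_in_closed V (S : submodule V) : submod_closed (submod_in S).
Proof.
split; first exact/asboolP/submod0.
by move=> a x y /asboolP Sx /asboolP Sy; apply/asboolP/submodP.
Qed.

HB.instance Definition _ V (S : submodule V) :=
  GRing.isSubmodClosed.Build R V (submod_in S) (submod_in_closed S).

Definition sub_type V (S : submodule V) : Type := {x : V | submod_in S x}.

HB.instance Definition _ V (S : submodule V) := SubChoice.on (sub_type S).
HB.instance Definition _ V (S : submodule V) :=
  [SubChoice_isSubLmodule of sub_type S by <:].

(** Stating the carrier directly as a module keeps the inference of the module
    structure out of the types of the maps below. *)
Definition sub V (S : submodule V) : lmodType R := sub_type S.

Definition incl V (S : submodule V) : {linear sub S -> V} := \val : sub_type S -> V.

Lemma inclP V (S : submodule V) (x : sub S) : S (incl S x).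
Proof. exact/asboolP/(valP x). Qed.

Lemma incl_inj V (S : submodule V) : injective (incl S).
Proof. exact: val_inj. Qed.

Definition mksub V (S : submodule V) x (Sx : S x) : sub S :=
  (Sub x (asboolT Sx) : sub_type S).

Lemma incl_mksub V (S : submodule V) x (Sx : S x) : incl S (mksub Sx) = x.
Proof. exact: SubK. Qed.

Fact corestr_linear U V (S : submodule V) (f : {linear U -> V})
  (fS : forall x, S (f x)) : linear (fun x => mksub (fS x)).
Proof.
move=> a x y; apply: (@incl_inj V S).
by rewrite (linearP (incl S)) !incl_mksub (linearP f).
Qed.

Definition corestr U V (S : submodule V) (f : {linear U -> V})
  (fS : forall x, S (f x)) : {linear U -> sub S} := linmap (corestr_linear fS).

Lemma incl_corestr U V (S : submodule V) (f : {linear U -> V})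
  (fS : forall x, S (f x)) x : incl S (corestr fS x) = f x.
Proof. exact: incl_mksub. Qed.

Fact ker_closed U V (f : {linear U -> V}) a x y :
  f x = 0 -> f y = 0 -> f (a *: x + y) = 0.
Proof. by move=> fx fy; rewrite linearP fx fy scaler0 addr0. Qed.

Definition ker U V (f : {linear U -> V}) : submodule U :=
  Submodule (raddf0 f) (ker_closed (f := f)).

Fact im_closed U V (f : {linear U -> V}) a x y :
  (exists z, f z = x) -> (exists z, f z = y) -> exists z, f z = a *: x + y.
Proof. by move=> [z <-] [t <-]; exists (a *: z + t); rewrite linearP. Qed.

Definition im U V (f : {linear U -> V}) : submodule V :=
  Submodule (ex_intro _ 0 (raddf0 f)) (im_closed (f := f)).

Definition short_exact U V W (f : {linear U -> V}) (g : {linear V -> W}) :=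
  [/\ injective f, surj g & exact_at f g].

Lemma ker_short_exact U V (f : {linear U -> V}) :
  surj f -> short_exact (incl (ker f)) f.
Proof.
move=> fsurj; split=> //; first exact: incl_inj.
move=> y; split=> [fy | [x <-]]; last exact: (inclP (S := ker f)).
by exists (mksub (S := ker f) fy); rewrite incl_mksub.
Qed.

End LinearMaps.

(** * Finite partial resolutions *)

Section FreeModules.
Context (R : nzRingType).
Implicit Types (A B C M N : lmodType R) (I J : finType).

Notation free I := {ffun I -> R^o}.

Fact from_free_linear I M (e : I -> M) :
  linear (fun x : free I => \sum_i x i *: e i).
Proof.
move=> a x y; rewrite scaler_sumr -big_split /=; apply: eq_bigr => i _.
by rewrite !ffunE scalerDl scalerA.
Qed.

Definition from_free I M (e : I -> M) : {linear free I -> M} :=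
  linmap (from_free_linear e).

Lemma ffunZD I M a (x y : {ffun I -> M}) i : (a *: x + y) i = a *: x i + y i.
Proof. by rewrite !ffunE. Qed.

Lemma ffunZ I M a (x : {ffun I -> M}) i : (a *: x) i = a *: x i.
Proof. by rewrite ffunE. Qed.

Definition basis I (i : I) : free I := [ffun j => (j == i)%:R].

Lemma basisE I (x : free I) : x = \sum_i x i *: basis i.
Proof.
apply/ffunP => j; rewrite sum_ffunE (bigD1 j) //= !ffunE eqxx [_ *: _]mulr1.
rewrite big1 ?addr0// => i ij.
by rewrite !ffunE eq_sym (negbTE ij) scaler0.
Qed.

Lemma linear_freeE I M (f : {linear free I -> M}) x :
  f x = \sum_i x i *: f (basis i).
Proof.
rewrite [in LHS](basisE x) raddf_sum; apply: eq_bigr => i _.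
exact: (linearZ_LR f).
Qed.

Lemma from_free_basis I M (e : I -> M) i : from_free e (basis i) = e i.
Proof.
rewrite [LHS](bigD1 i) //= ffunE eqxx scale1r big1 ?addr0// => j ji.
by rewrite ffunE (negbTE ji) scale0r.
Qed.

Lemma free_projective I : projective ({ffun I -> R^o} : lmodType R).
Proof.
move=> M N p f psurj.
have [e eP] := choice (fun i => psurj (f (basis i))).
exists (from_free e) => x.
rewrite (linear_freeE f) -[LHS]/((p \o from_free e) x) linear_freeE.
apply: eq_bigr => i _; rewrite -eP; congr (_ *: _); congr (p _).
exact: from_free_basis.
Qed.

(** Exact sequences are given by maps and not by subobjects; this replaces the
    corestriction to a submodule. *)
Lemma factor_inj (U V K : lmodType R) (j : {linear K -> V}) (f : {linear U -> V}) :
  injective j -> (forall x, exists y, j y = f x) ->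
  exists h : {linear U -> K}, forall x, j (h x) = f x.
Proof.
move=> jinj /choice[h hP].
have hl : linear h by move=> a x y; apply: jinj; rewrite linearP !hP linearP.
by exists (linmap hl).
Qed.

(** [fin_res k M] asks for k finitely generated free modules at the beginning
    of a resolution of M, so it is the property FP_(k-1). The shift gives the
    recursion a trivial base case. *)
Fixpoint fin_res (k : nat) M : Prop :=
  if k is k'.+1 then
    exists (I : finType) (K : lmodType R) (j : {linear K -> free I})
      (p : {linear free I -> M}), short_exact j p /\ fin_res k' K
  else True.

Section Sum.
Context (I J : finType).

Fact free_inl_linear :
  linear (fun x : free I =>
    [ffun s => if s is inl i then x i else 0] : free (I + J)%type).
Proof.
by move=> a x y; apply/ffunP => -[i|j]; rewrite !ffunE // scaler0 addr0.
Qed.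
Definition free_inl := linmap free_inl_linear.

Fact free_prl_linear :
  linear (fun x : free (I + J)%type => [ffun i => x (inl i)] : free I).
Proof. by move=> a x y; apply/ffunP => i; rewrite !ffunE. Qed.
Definition free_prl := linmap free_prl_linear.

Fact free_prr_linear :
  linear (fun x : free (I + J)%type => [ffun j => x (inr j)] : free J).
Proof. by move=> a x y; apply/ffunP => i; rewrite !ffunE. Qed.
Definition free_prr := linmap free_prr_linear.

End Sum.

(** The horseshoe lemma: covers of the two ends give a cover of the middle by
    the direct sum, and the kernels of the three covers form a short exact
    sequence to which induction applies. *)
Lemma fin_res_ext k A B C (f : {linear A -> B}) (g : {linear B -> C}) :
  short_exact f g -> fin_res k A -> fin_res k C -> fin_res k B.
Proof.
elim: k A B C f g => // k IHk A B C f g [finj gsurj fg].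
move=> [IA [KA [jA [pA [[jAinj pAsurj jpA] KAk]]]]].
move=> [IC [KC [jC [pC [[jCinj pCsurj jpC] KCk]]]]].
have [h hP] := free_projective pC gsurj.
pose p x : B := f (pA (free_prl IA IC x)) + h (free_prr IA IC x).
have plin : linear p.
  by move=> a x y; rewrite /p !linearP scalerDr addrACA.
have gp x : g (linmap plin x) = pC (free_prr IA IC x).
  rewrite linmapE /p raddfD /= hP [X in X + _](_ : _ = 0) ?add0r //.
  by apply/fg; eexists.
have ker_il x : linmap plin ((lcomp (free_inl IA IC) jA) x) = 0.
  rewrite linmapE /p ?lcompE (_ : free_prl _ _ _ = jA x); last first.
    by apply/ffunP => i; rewrite !ffunE.
  rewrite (_ : free_prr _ _ _ = 0); last by apply/ffunP => i; rewrite !ffunE.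
  by rewrite (jpA _).2 ?raddf0 ?addr0 //; exists x.
have [|r rP] := @factor_inj (sub (ker (linmap plin))) _ _ jC
  (lcomp (free_prr IA IC) (incl _)) jCinj.
  move=> x; apply/jpC; rewrite -[LHS]gp.
  by rewrite (inclP (S := ker (linmap plin))) raddf0.
exists (IA + IC)%type, (sub (ker (linmap plin))), (incl _), (linmap plin); split.
  apply: ker_short_exact => b.
  have [y gy] := pCsurj (g b).
  have [a fa] : exists a, f a = b - h y.
    by apply/fg; rewrite raddfB /= hP gy subrr.
  have [x px] := pAsurj a.
  exists [ffun s => match s with inl i => x i | inr j => y j end].
  rewrite linmapE /p ?lcompE (_ : free_prl _ _ _ = x); last first.
    by apply/ffunP => i; rewrite !ffunE.
  rewrite (_ : free_prr _ _ _ = y); last by apply/ffunP => i; rewrite !ffunE.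
  by rewrite px fa subrK.
apply: (IHk _ _ _ (corestr (S := ker _) ker_il) r) => //; split.
- move=> x y /(congr1 (incl _)); rewrite !incl_corestr => exy.
  apply: jAinj; apply/ffunP => i.
  by have /ffunP/(_ (inl i)) := exy; rewrite !ffunE.
- move=> z.
  have [a fa] : exists a, f a = h (jC z).
    by apply/fg; rewrite hP; apply/jpC; exists z.
  have [x px] := pAsurj a.
  pose w : free (IA + IC)%type :=
    [ffun s => match s with inl i => - x i | inr j => jC z j end].
  have wr : free_prr _ _ w = jC z by apply/ffunP => i; rewrite !ffunE.
  have wker : linmap plin w = 0.
    rewrite linmapE /p wr (_ : free_prl _ _ w = - x); last first.
      by apply/ffunP => i; rewrite !ffunE.
    by rewrite !raddfN /= px fa addNr.
  exists (mksub (S := ker _) wker); apply: jCinj.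
  by rewrite rP lcompE incl_mksub.
- move=> x; split=> [rx0 | [y <-]].
    have rx : free_prr IA IC (incl _ x) = 0 by rewrite -[LHS]rP rx0 raddf0.
    have : linmap plin (incl _ x) = 0 := inclP (S := ker (linmap plin)) x.
    rewrite linmapE /p rx raddf0 addr0 => fpx.
    have /jpA[y jy] : pA (free_prl IA IC (incl _ x)) = 0.
      by apply: finj; rewrite fpx raddf0.
    exists y; apply: (@incl_inj _ _ (ker (linmap plin))).
    rewrite incl_corestr ?lcompE jy; apply/ffunP => -[i|j]; rewrite !ffunE //.
    by have /ffunP/(_ j) := rx; rewrite !ffunE.
  apply: jCinj; rewrite rP lcompE incl_corestr raddf0.
  by apply/ffunP => i; rewrite !ffunE.
Qed.

(** A cover of B also covers C; its kernel over C is an extension of A by the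
    kernel over B. *)
Lemma fin_res_quot k A B C (f : {linear A -> B}) (g : {linear B -> C}) :
  short_exact f g -> fin_res k A -> fin_res k.+1 B -> fin_res k.+1 C.
Proof.
move=> [finj gsurj fg] Ak [I [K [j [p [[jinj psurj jp] Kk]]]]].
pose q : {linear free I -> C} := lcomp g p.
have qsurj : surj q.
  by move=> c; have [b <-] := gsurj c; have [x <-] := psurj b; exists x.
exists I, (sub (ker q)), (incl _), q; split; first exact: ker_short_exact.
have qj x : q (j x) = 0.
  by rewrite /q lcompE (jp _).2 ?raddf0 //; exists x.
have [|r rP] := @factor_inj (sub (ker q)) _ _ f (lcomp p (incl _)) finj.
  by move=> x; apply/fg; exact: (inclP (S := ker q)).
apply: (fin_res_ext (f := corestr (S := ker q) qj) (g := r)) => //; split.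
- by move=> x y /(congr1 (incl _)); rewrite !incl_corestr => /jinj.
- move=> a; have [x px] := psurj (f a).
  have qx : q x = 0 by rewrite /q lcompE px; apply/fg; exists a.
  by exists (mksub (S := ker q) qx); apply: finj; rewrite rP lcompE incl_mksub.
- move=> x; split=> [rx | [y <-]].
    have /jp[y jy] : p (incl _ x) = 0 by rewrite -[LHS]rP rx raddf0.
    by exists y; apply: (@incl_inj _ _ (ker q)); rewrite incl_corestr.
  by apply: finj; rewrite rP lcompE incl_corestr raddf0; apply/jp; exists y.
Qed.

(** The kernel of a retraction of a free module onto M is again a retract of
    this free module, so the same free module serves in every degree. *)
Lemma fin_res_retract k M I (s : {linear free I -> M}) (h : {linear M -> free I}) :
  (forall x, s (h x) = x) -> fin_res k M.
Proof.
elim: k M s h => // k IHk M s h sh.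
exists I, (sub (ker s)), (incl _), s; split.
  by apply: ker_short_exact => x; exists (h x).
have cl : linear (fun x => x - h (s x)).
  by move=> a x y; rewrite (linearP s) (linearP h) opprD addrACA scalerBr.
have cker x : s (linmap cl x) = 0 by rewrite linmapE raddfB /= sh subrr.
apply: (IHk _ (corestr (S := ker s) cker) (incl _)) => x.
apply: (@incl_inj _ _ (ker s)); rewrite incl_corestr linmapE.
by have -> : s (incl _ x) = 0 := inclP (S := ker s) x; rewrite raddf0 subr0.
Qed.

Lemma fin_res0 k M : (forall x : M, x = 0) -> fin_res k M.
Proof.
move=> M0; have cl : linear (fun _ : M => 0 : free void).
  by move=> a x y; rewrite scaler0 addr0.
apply: (fin_res_retract _ (s := from_free (fun=> 0)) (h := linmap cl)) => x.
by rewrite [x]M0 !raddf0.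
Qed.

Lemma fin_res_free k I : fin_res k (free I).
Proof. exact: (@fin_res_retract _ _ _ idfun idfun). Qed.

Lemma fin_res_le k l M : (k <= l)%N -> fin_res l M -> fin_res k M.
Proof.
elim: k l M => // k IHk [|l] M // kl [I [K [j [p [jp Kl]]]]].
by exists I, K, j, p; split=> //; exact: IHk Kl.
Qed.

Lemma fin_res_iso k M N (f : {linear M -> N}) :
  injective f -> surj f -> fin_res k M -> fin_res k N.
Proof.
case: k => // k finj fsurj [I [K [j [p [[jinj psurj jp] Kk]]]]].
exists I, K, j, (lcomp f p); split=> //; split=> //.
  by move=> y; have [x <-] := fsurj y; have [z <-] := psurj x; exists z.
move=> x; rewrite -jp lcompE; split=> [fpx | ->]; last exact: raddf0.
by apply: finj; rewrite fpx raddf0.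
Qed.

Lemma fin_res_sub_eq k M (S S' : submodule M) :
  (forall x, S x <-> S' x) -> fin_res k (sub S) -> fin_res k (sub S').
Proof.
move=> SS'.
have f x : S' (incl S x) by apply/SS'; exact: inclP.
apply: (fin_res_iso (f := corestr f)).
  by move=> x y /(congr1 (incl _)); rewrite !incl_corestr => /incl_inj.
move=> y; have Sy : S (incl _ y) by apply/SS'; exact: inclP.
exists (mksub Sy); apply: (@incl_inj _ _ S').
by rewrite incl_corestr incl_mksub.
Qed.

(** Schanuel's lemma in the form needed: the finiteness of the first syzygy
    does not depend on the cover. The pullback P of the two covers of M is an
    extension of one free module by the kernel of the other cover, and it is
    also an extension of [ker p] by a free module. *)
Lemma fin_res_ker k M I (p : {linear free I -> M}) :
  surj p -> fin_res k.+1 M -> fin_res k (sub (ker p)).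
Proof.
case: k => // k psurj [I' [K [j [p' [[jinj p'surj jp'] Kk]]]]].
have [h hP] := free_projective p' psurj.
have dl : linear (fun x : free (I' + I)%type =>
    p (free_prr _ _ x) - p' (free_prl _ _ x)).
  move=> a x y; rewrite (linearP (free_prr _ _)) (linearP (free_prl _ _)).
  by rewrite (linearP p) (linearP p') opprD scalerBr addrACA.
pose P := ker (linmap dl).
have Kl (x : K) : linmap dl ((lcomp (free_inl I' I) j) x) = 0.
  rewrite linmapE ?lcompE (_ : free_prl _ _ _ = j x); last first.
    by apply/ffunP => i; rewrite !ffunE.
  rewrite (_ : free_prr _ _ _ = 0); last by apply/ffunP => i; rewrite !ffunE.
  by rewrite raddf0 sub0r (jp' _).2 ?oppr0 //; exists x.
have Pk : fin_res k.+1 (sub P).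
  apply: (fin_res_ext (f := corestr (S := P) Kl)
    (g := lcomp (free_prr _ _) (incl P))) => //.
    split.
    - move=> x y /(congr1 (incl _)); rewrite !incl_corestr => exy.
      apply: jinj; apply/ffunP => i.
      by have /ffunP/(_ (inl i)) := exy; rewrite !ffunE.
    - move=> y; have [x px] := p'surj (p y).
      pose w : free (I' + I)%type :=
        [ffun s => match s with inl i => x i | inr j => y j end].
      have wr : free_prr _ _ w = y by apply/ffunP => i; rewrite !ffunE.
      have wP : linmap dl w = 0.
        rewrite linmapE wr (_ : free_prl _ _ w = x) ?px ?subrr //.
        by apply/ffunP => i; rewrite !ffunE.
      by exists (mksub (S := P) wP); rewrite lcompE incl_mksub.
    - move=> x; rewrite lcompE; split=> [xr | [y <-]].
        have : linmap dl (incl P x) = 0 := inclP x.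
        rewrite linmapE xr raddf0 sub0r => /eqP.
        rewrite oppr_eq0 => /eqP/jp'[y jy].
        exists y; apply: (@incl_inj _ _ P); rewrite incl_corestr ?lcompE jy.
        apply/ffunP => -[i|i]; rewrite !ffunE //.
        by have /ffunP/(_ i) := xr; rewrite !ffunE.
      by rewrite incl_corestr; apply/ffunP => i; rewrite !ffunE.
  exact: fin_res_free.
have gl : linear (fun x : sub P =>
    free_prr _ _ (incl P x) - h (free_prl _ _ (incl P x))).
  move=> a x y; rewrite (linearP (incl P)) (linearP (free_prr _ _)).
  by rewrite (linearP (free_prl _ _)) (linearP h) opprD scalerBr addrACA.
have gk x : p (linmap gl x) = 0.
  by rewrite linmapE raddfB /= hP; exact: (inclP (S := P)).
(* The graph of the lifting h is a free complement in P of the kernel of p. *)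
have fl : linear (fun x : free I' =>
   [ffun s => match s with inl i => x i | inr i => h x i end] : free (I' + I)%type).
  by move=> a x y; apply/ffunP => -[i|i]; rewrite !ffunE // linearP !ffunE.
have prl x : free_prl _ _ (linmap fl x) = x by apply/ffunP => i; rewrite !ffunE.
have prr x : free_prr _ _ (linmap fl x) = h x by apply/ffunP => i; rewrite !ffunE.
have fP x : linmap dl (linmap fl x) = 0.
  by rewrite linmapE prl prr hP subrr.
apply: (fin_res_quot (f := corestr (S := P) fP) (g := corestr (S := ker p) gk)) => //;
  last exact: fin_res_free.
split.
- move=> x y /(congr1 (incl _)); rewrite !incl_corestr => exy.
  by rewrite -[x]prl exy prl.
- move=> y.
  pose w : free (I' + I)%type :=
    [ffun s => match s with inl i => 0 | inr i => incl _ y i end].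
  have wr : free_prr _ _ w = incl _ y by apply/ffunP => i; rewrite !ffunE.
  have wl : free_prl _ _ w = 0 by apply/ffunP => i; rewrite !ffunE.
  have wP : linmap dl w = 0.
    rewrite linmapE wr wl raddf0 subr0; exact: (inclP (S := ker p)).
  exists (mksub (S := P) wP); apply: (@incl_inj _ _ (ker p)).
  by rewrite incl_corestr linmapE incl_mksub wr wl raddf0 subr0.
- move=> x; split=> [|[y <-]].
    move/(congr1 (incl _)); rewrite incl_corestr raddf0 linmapE => /subr0_eq xrl.
    exists (free_prl _ _ (incl P x)); apply: (@incl_inj _ _ P).
    rewrite incl_corestr; apply/ffunP => -[i|i].
      by rewrite !ffunE.
    by have /ffunP/(_ i) := xrl; rewrite !ffunE => ->.
  apply: (@incl_inj _ _ (ker p)); rewrite incl_corestr linmapE incl_corestr raddf0.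
  by rewrite prl prr subrr.
Qed.

Lemma fin_res_ffun k M I : fin_res k M -> fin_res k ({ffun I -> M} : lmodType R).
Proof.
elim: k M => // k IHk M [J [K [j [p [[jinj psurj jp] Kk]]]]].
have jl : linear (fun x : {ffun I -> K} =>
    [ffun s => j (x s.1) s.2] : free (I * J)%type).
  by move=> a x y; apply/ffunP => s; rewrite !ffunE linearP !ffunE.
have pl : linear (fun x : free (I * J)%type =>
    [ffun i => p [ffun l => x (i, l)]] : {ffun I -> M}).
  move=> a x y; apply/ffunP => i; rewrite !ffunE -linearP; congr (p _).
  by apply/ffunP => l; rewrite !ffunE.
exists (I * J)%type, {ffun I -> K}, (linmap jl), (linmap pl).
split; last exact: IHk.
split.
- move=> x y /ffunP exy; apply/ffunP => i; apply: jinj; apply/ffunP => l.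
  by have := exy (i, l); rewrite !ffunE.
- move=> y; have [x xP] := choice (fun i => psurj (y i)).
  exists [ffun s => x s.1 s.2]; apply/ffunP => i; rewrite ffunE -[RHS]xP.
  by congr (p _); apply/ffunP => l; rewrite !ffunE.
- move=> x; split=> [px | [y <-]].
    have /choice[y yP] : forall i, exists y, j y = [ffun l => x (i, l)].
      by move=> i; apply/jp; have /ffunP/(_ i) := px; rewrite !ffunE.
    exists [ffun i => y i]; apply/ffunP => -[i l].
    by rewrite !ffunE yP ffunE.
  apply/ffunP => i; rewrite !ffunE; apply/jp; exists (y i).
  by apply/ffunP => l; rewrite !ffunE.
Qed.

(** Projectivity splits the map from a free module given by the generators. *)
Lemma fg_retract P : projective P -> finitely_generated P ->
  exists (n : nat) (s : {linear free 'I_n -> P}) (h : {linear P -> free 'I_n}),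
    forall x, s (h x) = x.
Proof.
move=> Pproj [n [e eP]].
have ssurj : surj (from_free e).
  by move=> x; have [c ->] := eP x; exists [ffun i => c i];
    apply: eq_bigr => i _; rewrite ffunE.
have [h hP] := Pproj _ _ (from_free e) idfun ssurj.
by exists n, (from_free e), h => x; rewrite hP.
Qed.

(** Dimension shifting: M is the quotient of C_0 by a module that the rest of
    the complex resolves, with one degree less to control. *)
Lemma fin_res_shift r M (C : nat -> lmodType R)
    (d : forall n, {linear C n.+1 -> C n}) (e : {linear C 0%N -> M}) :
  surj e -> exact_at (d 0%N) e -> (forall n, exact_at (d n.+1) (d n)) ->
  (forall n, (n < r)%N -> fin_res (r - n) (C n)) -> fin_res r M.
Proof.
elim: r M C d e => // r IHr M C d e esurj de dd Cr.
have e0 x : ker e (d 0%N x) by apply/de; exists x.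
apply: (fin_res_quot (ker_short_exact esurj)); last exact: (Cr 0%N).
apply: (IHr _ (fun n => C n.+1) (fun n => d n.+1) (corestr e0)) => //.
- move=> y; have /de[x dx] : e (incl _ y) = 0 := inclP (S := ker e) y.
  by exists x; apply: (@incl_inj _ _ (ker e)); rewrite incl_corestr.
- move=> x; split=> [|[y <-]].
    by move/(congr1 (incl _)); rewrite incl_corestr raddf0 => /dd.
  apply: (@incl_inj _ _ (ker e)); rewrite incl_corestr raddf0.
  by apply/dd; exists y.
- by move=> n nr; exact: (Cr n.+1).
Qed.

Lemma fin_res_resolution r M (P : nat -> lmodType R)
    (d : forall n, {linear P n.+1 -> P n}) (e : {linear P 0%N -> M}) :
  projective_resolution d e ->
  (forall n, (n < r)%N -> finitely_generated (P n)) -> fin_res r M.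
Proof.
move=> [Pproj esurj de dd] Pfg; apply: (fin_res_shift esurj de dd) => n nr.
have [l [s [h sh]]] := fg_retract (Pproj n) (Pfg n nr).
exact: (fin_res_retract _ sh).
Qed.

Fact from_malg_linear (X : choiceType) M (e : X -> M) :
  linear (fun x : {malg R[X]} => \sum_(k <- msupp x) x@_k *: e k).
Proof.
have E x : \sum_(k <- msupp x) x@_k *: e k =
  malg_lift (fun k => addmap (scalerDl (e k))) x by [].
move=> a x y; rewrite !E raddfD /=; congr (_ + _).
rewrite (malg_liftEw _ (msuppZ_le a x)) /malg_lift scaler_sumr.
by apply: eq_bigr => k _; rewrite /= mcoeffZ scalerA.
Qed.

(** Gathers existential data, so that a single choice picks them together. *)
Record cover M := Cover {
  cover_mod : lmodType R;
  cover_ker : lmodType R;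
  cover_incl : {linear cover_ker -> cover_mod};
  cover_map : {linear cover_mod -> M}
}.

(** When no finiteness is left, the free module on all the elements of M serves
    as the cover, so that a resolution can always be continued. *)
Lemma cover_exists r M : fin_res r M ->
  exists c : cover M, [/\ short_exact (cover_incl c) (cover_map c),
    projective (cover_mod c), fin_res r.-1 (cover_ker c)
    & (0 < r)%N -> finitely_generated (cover_mod c)].
Proof.
case: r => [_|r [I [K [j [p [jp Kr]]]]]].
  pose p := linmap (from_malg_linear (id : M -> M)).
  have pU x : p << x >> = x.
    rewrite linmapE; have E := @malg_liftU M R M (fun k => addmap (scalerDl k)) 1 x.
    by rewrite -[RHS]scale1r -[RHS]E.
  exists (Cover (incl (ker p)) p); split=> //=.
    by apply: ker_short_exact => x; exists << x >>.
  move=> A B q f qsurj.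
  have [e eP] := choice (fun k => qsurj (f << k >>)).
  exists (linmap (from_malg_linear e)) => x.
  rewrite linmapE raddf_sum [in RHS](monalgE x) raddf_sum.
  apply: eq_bigr => k _; rewrite /= linearZ /= eP -linearZ; congr (f _).
  by apply/malgP => l; rewrite mcoeffZ !mcoeffU mulr_natr.
exists (Cover j p); split=> //=; first exact: free_projective.
move=> _; exists #|I|, (fun i => basis (enum_val i)) => x.
exists (fun i => x (enum_val i)); rewrite [LHS]basisE.
by rewrite (reindex _ (onW_bij _ (enum_val_bij I))).
Qed.

(** Covers of the successive syzygies are spliced together. The number of steps
    in which finiteness is still required is carried along with the syzygy. *)
Lemma resolution_of_fin_res r M : fin_res r M ->
  exists (P : nat -> lmodType R) (d : forall n, {linear P n.+1 -> P n})
         (e : {linear P 0%N -> M}),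
    projective_resolution d e /\
    forall n, (n < r)%N -> finitely_generated (P n).
Proof.
pose state := {rM : nat * lmodType R | fin_res rM.1 rM.2}.
pose cov (s : state) := sval (cid (cover_exists (svalP s))).
have covP (s : state) := svalP (cid (cover_exists (svalP s))).
have Kr (s : state) : fin_res (sval s).1.-1 (cover_ker (cov s)).
  by have [] := covP s.
move=> Mr; pose st n : state :=
  iter n (fun s => exist _ (_, _) (Kr s)) (exist _ (r, M) Mr).
have stE n : (sval (st n)).1 = (r - n)%N.
  by elim: n => [|n IHn] /=; rewrite ?subn0 // -/(st n) IHn subnS.
exists (fun n => cover_mod (cov (st n))).
exists (fun n => lcomp (cover_incl (cov (st n))) (cover_map (cov (st n.+1)))).
exists (cover_map (cov (st 0%N))); split.
  split.
  - by move=> n; have [] := covP (st n).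
  - by have [[]] := covP (st 0%N).
  - have [[_ _ ex] _ _ _] := covP (st 0%N).
    have [[_ sj _] _ _ _] := covP (st 1%N).
    move=> y; rewrite ex; split=> [[x <-]|[x <-]]; last by eexists.
    by have [z <-] := sj x; exists z.
  - move=> n y; have [[_ _ ex] _ _ _] := covP (st n.+1).
    have [[inj _ _] _ _ _] := covP (st n).
    have [[_ sj _] _ _ _] := covP (st n.+2).
    rewrite lcompE; split=> [y0|[x <-]].
      have /ex[x <-] : cover_map (cov (st n.+1)) y = 0.
        by apply: inj; rewrite y0 raddf0.
      by have [z <-] := sj x; exists z.
    by rewrite (_ : cover_map _ _ = 0) ?raddf0 //; apply/ex; eexists.
move=> n nr; have [_ _ _] := covP (st n); apply.
by rewrite stE subn_gt0.
Qed.

End FreeModules.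

(** * Formal integral sums and their images *)

Section IntegralChains.
Implicit Types K L M : choiceType.

Lemma malgUz K (c : int) (k : K) : << c *g k >> = << k >> *~ c :> {malg int[K]}.
Proof.
have := raddfMz (addmap (monalgUD (G := int) k)) c 1.
by rewrite /= -mulrzr mul1r intz.
Qed.

(** Integral coefficients come for free: additivity alone reduces an equality
    to the basis. Most identities below are proved this way. *)
Lemma chain_ext K (V : zmodType) (f g : {malg int[K]} -> V) :
  {morph f : x y / x + y} -> {morph g : x y / x + y} ->
  (forall k, f << k >> = g << k >>) -> f =1 g.
Proof.
move=> fD gD fg x; rewrite (monalgE x).
rewrite -[LHS]/(addmap fD _) -[RHS]/(addmap gD _) !raddf_sum.
by apply: eq_bigr => k _; rewrite malgUz !raddfMz /= fg.
Qed.

Definition push K L (f : K -> L) : {malg int[K]} -> {malg int[L]} :=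
  malg_lift (fun k => addmap (monalgUD (G := int) (f k))).

HB.instance Definition _ K L (f : K -> L) := GRing.Additive.on (push f).

Lemma pushU K L (f : K -> L) c k : push f << c *g k >> = << c *g f k >>.
Proof. exact: malg_liftU. Qed.

Lemma push_comp K L M (f : L -> M) (g : K -> L) x :
  push f (push g x) = push (f \o g) x.
Proof.
move: x; apply: chain_ext => [x y|x y|k]; rewrite ?raddfD //.
by rewrite !pushU.
Qed.

Lemma eq_push_in K L (f g : K -> L) (x : {malg int[K]}) :
  {in msupp x, f =1 g} -> push f x = push g x.
Proof. by move=> fg; apply: eq_big_seq => k kx; rewrite /= fg. Qed.

(* Unification would otherwise unfold sums of formal sums when it compares
   unrelated chains. The other opacity commands have the same purpose. *)
#[global] Opaque push.

Lemma eq_push K L (f g : K -> L) : f =1 g -> push f =1 push g.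
Proof. by move=> fg x; apply: eq_push_in => k _. Qed.

Lemma push_id K (f : K -> K) : f =1 id -> push f =1 id.
Proof.
by move=> fid; apply: chain_ext => [x y|x y|k]; rewrite ?raddfD // pushU fid.
Qed.

Lemma mcoeff_push K L (f : K -> L) (x : {malg int[K]}) k :
  injective f -> (push f x)@_(f k) = x@_k.
Proof.
move=> finj; move: x; apply: chain_ext => [x y|x y|l]; rewrite ?raddfD //.
by rewrite pushU !mcoeffU (inj_eq finj).
Qed.

Lemma mcoeff_push_out K L (f : K -> L) (x : {malg int[K]}) l :
  (forall k, f k <> l) -> (push f x)@_l = 0.
Proof.
move=> fl; move: x; apply: chain_ext => [x y|x y|k]; rewrite ?raddfD ?addr0 //.
by rewrite pushU mcoeffU; case: eqP => // /fl.
Qed.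

Definition pull K L (f : K -> L) (x : {malg int[L]}) : {malg int[K]} :=
  [malg k in fset_set (f @^-1` [set` msupp x])%classic => x@_(f k)].

Lemma mcoeff_pull K L (f : K -> L) (x : {malg int[L]}) k :
  injective f -> (pull f x)@_k = x@_(f k).
Proof.
move=> finj; rewrite /pull mcoeffE in_fset_set; last first.
  by apply: finite_preimage => [? ? _ _ /finj//|]; exact: finite_fset.
rewrite mem_setE; case: ifPn => //.
by move=> kN; rewrite mcoeff_outdom //; apply: contraNN kN.
Qed.

#[global] Opaque pull.

End IntegralChains.

(** * Modules over a group ring *)

Section GroupModules.
Context (G : groupType).
Implicit Types (U V : lmodType (group_ring G)) (g : G).

(** Writing the basis elements as a constant keeps them apart from formal sums
    over other sets, and gives their type the ring structure. *)
Definition gelt g : group_ring G := << g >>.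

Lemma geltM g h : gelt (g * h)%g = gelt g * gelt h.
Proof. by rewrite [RHS]grmulUU mulr1. Qed.

Lemma gelt1 : gelt 1%g = 1. Proof. by []. Qed.

Lemma group_ring_ext (V : zmodType) (f f' : group_ring G -> V) :
  {morph f : x y / x + y} -> {morph f' : x y / x + y} ->
  (forall g, f (gelt g) = f' (gelt g)) -> f =1 f'.
Proof. exact: chain_ext. Qed.

Lemma gelt_linear U V (f : U -> V) :
  {morph f : x y / x + y} -> (forall g x, f (gelt g *: x) = gelt g *: f x) ->
  linear f.
Proof.
move=> fD fg a x y; rewrite fD; congr (_ + _); move: a {y}.
apply: (group_ring_ext (f := fun a => f (a *: x)) (f' := fun a => a *: f x)).
- by move=> a b; rewrite -fD -scalerDl.
- by move=> a b; rewrite -scalerDl.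
- by move=> g; exact: fg.
Qed.

Lemma gelt_closed U (S : U -> Prop) :
  S 0 -> (forall x y, S x -> S y -> S (x - y)) ->
  (forall g x, S x -> S (gelt g *: x)) ->
  forall a x y, S x -> S y -> S (a *: x + y).
Proof.
move=> S0 SB Sg.
have SN x : S x -> S (- x) by rewrite -sub0r; exact: SB.
have SD x y : S x -> S y -> S (x + y).
  by move=> Sx /SN Sy; rewrite -[y]opprK; exact: SB.
have SZ (c : int) x : S x -> S (x *~ c).
  move=> Sx; have Sn n : S (x *+ n) by elim: n => // n IHn; rewrite mulrS; exact: SD.
  by case: c => n; [exact: Sn | exact/SN/Sn].
move=> a x y Sx Sy; apply: (SD) => //; rewrite (monalgE a) scaler_suml.
apply: (big_ind S S0 SD) => g _.
rewrite malgUz (_ : _ *: x = (gelt g *: x) *~ a@_g); first exact/SZ/Sg.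
by rewrite -[LHS]/(addmap (scalerDl x) _) raddfMz.
Qed.

End GroupModules.

(** The action is an argument, as the module structure on the formal sums
    depends on it. *)
Definition permod_type (G : groupType) (X : choiceType) (to : gset G X) : Type :=
  {malg int[X]}.

HB.instance Definition _ (G : groupType) (X : choiceType) (to : gset G X) :=
  GRing.Zmodule.on (permod_type to).

Section PermutationModule.
Context (G : groupType) (X : choiceType) (to : gset G X).
Notation permodT := (permod_type to).

Fact push_mulrz (x : permodT) g :
  {morph (fun c : int => push (to g) x *~ c) : c d / c + d}.
Proof. by move=> c d; rewrite mulrzDr. Qed.

Definition perm_scale (a : group_ring G) (x : permodT) : permodT :=
  malg_lift (fun g => addmap (push_mulrz x g)) a.

Lemma perm_scaleU g x : perm_scale (gelt g) x = push (to g) x.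
Proof. by rewrite /perm_scale malg_liftU. Qed.

Lemma perm_scaleDl x : {morph perm_scale^~ x : a b / a + b}.
Proof. by move=> a b; exact: raddfD. Qed.

Lemma perm_scaleDr : right_distributive perm_scale +%R.
Proof.
move=> a x y; rewrite /perm_scale /malg_lift -big_split /=; apply: eq_bigr => g _.
by rewrite raddfD mulrzDl.
Qed.

Lemma perm_scaleA a b x : perm_scale a (perm_scale b x) = perm_scale (a * b) x.
Proof.
move: a; apply: chain_ext => [a c|a c|g]; first exact: perm_scaleDl.
  by rewrite mulrDl perm_scaleDl.
move: b; apply: chain_ext => [a c|a c|h].
- by rewrite perm_scaleDl perm_scaleDr.
- by rewrite mulrDr perm_scaleDl.
rewrite -[<< g >>]/(gelt g) -[<< h >>]/(gelt h) -geltM !perm_scaleU push_comp.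
by apply: eq_push => y; rewrite /= gactM.
Qed.

Lemma perm_scale1 : left_id 1 perm_scale.
Proof. by move=> x; rewrite -gelt1 perm_scaleU push_id // => y; exact: gact1. Qed.

HB.instance Definition _ := GRing.Zmodule_isLmodule.Build (group_ring G) permodT
  perm_scaleA perm_scale1 perm_scaleDr perm_scaleDl.

Definition permod : lmodType (group_ring G) := permodT.

Lemma gelt_permod g (x : permod) : gelt g *: x = push (to g) x.
Proof. exact: perm_scaleU. Qed.

Lemma mcoeff_gelt g (x : permod) y : (gelt g *: x)@_y = x@_(to g^-1%g y).
Proof.
have gK : cancel (to g^-1%g) (to g) by move=> z; rewrite -gactM mulgV gact1.
have gK' : cancel (to g) (to g^-1%g) by move=> z; rewrite -gactM mulVg gact1.
by rewrite gelt_permod -{1}[y]gK mcoeff_push //; exact: can_inj gK'.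
Qed.

End PermutationModule.

(** * Free right actions and tensor products *)

Record free_ract (H : groupType) (X : Type) := FreeRact {
  ract :> X -> H -> X;
  ract1 : forall x, ract x 1%g = x;
  ractM : forall x h k, ract x (h * k)%g = ract (ract x h) k;
  ract_inj : forall x, injective (ract x)
}.

Section RightAction.
Context (H : groupType) (X : choiceType) (r : free_ract H X).
Implicit Types (x : {malg int[X]}) (w : X) (h : H) (a b : group_ring H).

(** The restriction of a chain to the coset wH, which the free action
    identifies with H. The slices at all w determine a chain, and they exhibit
    the formal sums over the set as a sum of copies of Z[H]. *)
Definition slice w x : group_ring H := pull (r w) x.

Lemma mcoeff_slice w x h : (slice w x)@_h = x@_(r w h).
Proof. by rewrite mcoeff_pull //; exact: ract_inj. Qed.

Lemma sliceD w : {morph slice w : x y / x + y}.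
Proof. by move=> x y; apply/malgP => h; rewrite !(mcoeffD, mcoeff_slice). Qed.

HB.instance Definition _ w := GRing.isNmodMorphism.Build {malg int[X]} (group_ring H)
  (slice w) (addmap0 (sliceD w), sliceD w).

Lemma slice_eq0 x : (forall w, slice w x = 0) -> x = 0.
Proof.
move=> x0; apply/malgP => w.
by rewrite -[w](ract1 r) -mcoeff_slice x0 !mcoeff0.
Qed.

Lemma mcoeff_mul_gelt a h k : (a * gelt h)@_k = a@_(k * h^-1)%g.
Proof.
move: a; apply: chain_ext => [a b|a b|l]; rewrite ?mulrDl ?mcoeffD //.
rewrite [_ * _]grmulUU mulr1 !mcoeffU; congr (_ *+ nat_of_bool _).
by apply/eqP/eqP => [<-|->]; rewrite ?mulgK ?mulgVK.
Qed.

Fact push_ract_mulrz x h :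
  {morph (fun c : int => push (r^~ h) x *~ c) : c d / c + d}.
Proof. by move=> c d; rewrite mulrzDr. Qed.

(** The right action of the group ring; slices turn it into the product. *)
Definition rmul x a : {malg int[X]} :=
  malg_lift (fun h => addmap (push_ract_mulrz x h)) a.

Lemma rmul_gelt x h : rmul x (gelt h) = push (r^~ h) x.
Proof. by rewrite /rmul malg_liftU. Qed.

Lemma rmulDr x : {morph rmul x : a b / a + b}.
Proof. by move=> a b; exact: raddfD. Qed.

Lemma rmulDl a : {morph rmul^~ a : x y / x + y}.
Proof.
move=> x y; rewrite /rmul /malg_lift -big_split /=; apply: eq_bigr => g _.
by rewrite raddfD mulrzDl.
Qed.

#[global] Opaque rmul.

Lemma slice_rmul w x a : slice w (rmul x a) = slice w x * a.
Proof.
move: a; apply: chain_ext => [a b|a b|h]; rewrite ?rmulDr ?raddfD ?mulrDr //.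
rewrite -/(gelt h) rmul_gelt; apply/malgP => k.
have rK h' z : r (r z h') h'^-1%g = z by rewrite -ractM mulgV ract1.
rewrite mcoeff_slice mcoeff_mul_gelt mcoeff_slice.
rewrite -[X in (push _ _)@_X = _](_ : r (r w (k * h^-1)%g) h = _).
  by rewrite (mcoeff_push (f := r^~ h)) // => y z eyz; rewrite -[y](rK h) eyz rK.
by rewrite -ractM mulgVK.
Qed.

Lemma slice_push w a : slice w (push (r w) a) = a.
Proof. by apply/malgP => h; rewrite mcoeff_slice mcoeff_push //; exact: ract_inj. Qed.

Lemma push_slice_out w a z : (forall h, r w h <> z) -> (push (r w) a)@_z = 0.
Proof. exact: mcoeff_push_out. Qed.

End RightAction.

(** Here E is a projector onto B that commutes with the right action of H. It
    need not commute with the left action: it only serves to show that B is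
    flat over Z[H], as a direct summand of a free module. *)
Section InducedModules.
Context (G H : groupType) (X : choiceType) (to : gset G X) (r : free_ract H X).
Context (tor : forall g w h, to g (r w h) = r (to g w) h).
Notation V := (permod to).
Context (B : submodule V) (E : {malg int[X]} -> {malg int[X]}).
Context (ED : {morph E : x y / x + y}).
Context (EB : forall x, B (E x)).
Context (BE : forall x, B x -> E x = x).
Context (Er : forall x h, E (push (r^~ h) x) = push (r^~ h) (E x)).
Implicit Types (I J : finType).
Notation free I := {ffun I -> (group_ring H)^o}.

Lemma slice_gelt g w (x : V) : slice r w (gelt g *: x) = slice r (to g^-1%g w) x.
Proof. by apply/malgP => h; rewrite !mcoeff_slice mcoeff_gelt tor. Qed.

Lemma gelt_rmul g (x : V) a : rmul r (gelt g *: x) a = gelt g *: (rmul r x a : V).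
Proof.
rewrite !gelt_permod; move: a; apply: group_ring_ext => [a b|a b|h].
- exact: rmulDr.
- by rewrite rmulDr raddfD.
by rewrite !rmul_gelt !push_comp; apply: eq_push => w; rewrite /= tor.
Qed.

Lemma E_rmul x a : E (rmul r x a) = rmul r (E x) a.
Proof.
move: a; apply: group_ring_ext => [a b|a b|h]; rewrite ?rmulDr ?ED //.
by rewrite !rmul_gelt Er.
Qed.

Definition slices I w (x : {ffun I -> V}) : free I := [ffun i => slice r w (x i)].

(** For a submodule S of a free Z[H]-module F, this is the image of B (x) S in
    B (x) F, a power of B. Membership is tested on slices, so that no tensor
    product is constructed, and left exactness is immediate. *)
Definition tens_mem I (S : submodule (free I)) (x : {ffun I -> V}) : Prop :=
  (forall i, B (x i)) /\ (forall w, S (slices w x)).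

Fact tens_closed I (S : submodule (free I)) : forall a x y,
  tens_mem S x -> tens_mem S y -> tens_mem S (a *: x + y).
Proof.
apply: gelt_closed => [|x y [Bx Sx] [By Sy]|g x [Bx Sx]]; split=> i.
- by rewrite ffunE; exact: submod0.
- rewrite (_ : slices _ _ = 0); first exact: submod0.
  by apply/ffunP => j; rewrite !ffunE raddf0.
- rewrite !ffunE -scaleN1r addrC; exact: (submodP (-1) (By i) (Bx i)).
- rewrite (_ : slices _ _ = (-1) *: slices i y + slices i x).
    exact: (submodP (-1) (Sy i) (Sx i)).
  by apply/ffunP => j; rewrite !ffunE raddfB scaleN1r addrC.
- rewrite ffunE -[_ *: _]addr0; exact: (submodP _ (Bx i) (submod0 B)).
- rewrite (_ : slices _ _ = slices (to g^-1%g i) x) //.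
  by apply/ffunP => j; rewrite !ffunE slice_gelt.
Qed.

Fact tens0 I (S : submodule (free I)) : tens_mem S 0.
Proof.
split=> i; first by rewrite ffunE; exact: submod0.
rewrite (_ : slices _ _ = 0); first exact: submod0.
by apply/ffunP => j; rewrite !ffunE raddf0.
Qed.

Definition tens I (S : submodule (free I)) : submodule ({ffun I -> V} : lmodType _) :=
  Submodule (tens0 S) (tens_closed (S := S)).

Section Matrix.
Context (I J : finType) (f : {linear free J -> free I}).

(** The map id (x) f, given by the matrix of f acting from the right. *)
Definition tens_map (y : {ffun J -> V}) : {ffun I -> V} :=
  [ffun i => \sum_j rmul r (y j) (f (basis _ j) i)].

Lemma slices_tens_map w y : slices w (tens_map y) = f (slices w y).
Proof.
apply/ffunP => i; rewrite (linear_freeE f) sum_ffunE !ffunE raddf_sum.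
by apply: eq_bigr => j _; rewrite /= slice_rmul !ffunE.
Qed.

Lemma tens_map_linear : linear tens_map.
Proof.
apply: gelt_linear => [x y|g x]; apply/ffunP => i.
  rewrite [RHS]ffunE [LHS]ffunE [X in _ = X + _]ffunE [X in _ = _ + X]ffunE.
  by rewrite -big_split; apply: eq_bigr => j _; rewrite ffunE rmulDl.
rewrite [RHS]ffunZ [LHS]ffunE [X in _ = _ *: X]ffunE scaler_sumr.
by apply: eq_bigr => j _; rewrite ffunZ gelt_rmul.
Qed.

(** Right exactness. The cosets that meet the support of x are treated one at
    a time: a lifting v of the slice of x at w, transported to the coset wH,
    gives an element whose image agrees with x on this coset and vanishes on
    the others. The finite set U bounds the supports and shrinks. *)
Lemma tens_map_lift (x : {ffun I -> V}) :
  (forall w, exists v, f v = slices w x) -> exists y, tens_map y = x.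
Proof.
move=> fx; suff lift n (U : {fset X}) : (#|` U| <= n)%N -> forall x : {ffun I -> V},
    (forall i, (msupp (x i) `<=` U)%fset) ->
    (forall w, exists v, f v = slices w x) -> exists y, tens_map y = x.
  apply: (lift _ (\bigcup_(i in I) msupp (x i))%fset (leqnn _) x _ fx) => i.
  exact: bigfcup_sup.
have sub0 (W : {fset X}) (x' : {ffun I -> V}) : W = fset0 ->
    (forall i, (msupp (x' i) `<=` W)%fset) -> exists y, tens_map y = x'.
  move=> -> x'W; exists 0; rewrite (_ : x' = 0).
    exact: raddf0 (linmap tens_map_linear).
  apply/ffunP => i; rewrite ffunE; apply/malgP => w; rewrite mcoeff0.
  by apply: mcoeff_outdom; apply/negP => /(fsubsetP (x'W i)).
elim: n U => [|n IHn] U Un {}x xU {}fx.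
  by apply: (sub0 U) => //; apply/eqP; rewrite -cardfs_eq0 -leqn0.
have [U0|[w wU]] := fset_0Vmem U; first exact: (sub0 U).
have [v fv] := fx w.
pose y : {ffun J -> V} := [ffun j => push (r w) (v j)].
have sy : slices w (tens_map y) = slices w x.
  rewrite slices_tens_map -fv; congr (f _); apply/ffunP => j.
  by rewrite !ffunE slice_push.
have yout z i : (forall h, r w h <> z) -> (tens_map y i)@_z = 0.
  move=> zN; have s0 : slices z y = 0.
    apply/ffunP => j; rewrite !ffunE; apply/malgP => h.
    rewrite mcoeff_slice mcoeff0 push_slice_out // => k wk.
    by apply: (zN (k * h^-1)%g); rewrite ractM wk -ractM mulgV ract1.
  have /ffunP/(_ i) := slices_tens_map z y.
  by rewrite s0 raddf0 !ffunE => /malgP/(_ 1%g); rewrite mcoeff_slice ract1 mcoeff0.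
have [|i|u|z zP] := IHn (U `\ w)%fset _ (x - tens_map y).
- by move: Un; rewrite (cardfsD1 w) wU.
- have xyi : (x - tens_map y) i = x i - tens_map y i.
    by rewrite ffunE; congr (_ + _); rewrite ffunE.
  apply/fsubsetP => z; rewrite -mcoeff_neq0 xyi mcoeffB => zN.
  have [[h wz]|wz] := pselect (exists h, r w h = z).
    move: zN; rewrite -wz -!mcoeff_slice.
    have /ffunP/(_ i) := sy; rewrite [LHS]ffunE [RHS]ffunE => ->.
    by rewrite subrr eqxx.
  rewrite !inE; apply/andP; split.
    by apply: contra_notN wz => /eqP ->; exists 1%g; exact: ract1.
  apply: (fsubsetP (xU i)); rewrite -mcoeff_neq0; apply: contraNN zN => /eqP xz.
  rewrite xz yout ?subrr // => h wh.
  by apply: wz; exists h.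
- have [v' fv'] := fx u.
  exists (v' - slices u y); rewrite raddfB /= fv' -slices_tens_map.
  by apply/ffunP => i; rewrite !ffunE raddfB.
exists (z + y); have tD := raddfD (linmap tens_map_linear) z y.
by rewrite -[LHS]/(linmap tens_map_linear _) tD /= zP subrK.
Qed.

End Matrix.

(** A cover of K by a free module of rank J gives a cover of B (x) K by the
    power of B indexed by J, with kernel B (x) K' where K' is the kernel of
    the given cover. *)
Lemma tens_fin_res k I (K : lmodType (group_ring H)) (u : {linear K -> free I}) :
  injective u -> fin_res k K -> fin_res k (sub B) -> fin_res k (sub (tens (im u))).
Proof.
elim: k I K u => // k IHk I K u uinj [J [K' [j [p [[jinj psurj jp] K'k]]]]] Bk.
pose f := lcomp u p.
have fP v : im u (f v) by exists (p v).
have fB (y : {ffun J -> sub B}) : tens (im u) (tens_map f [ffun j => incl B (y j)]).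
  split=> [i|w]; last by rewrite slices_tens_map.
  rewrite ffunE; apply: (big_ind B) => [|a b Ba Bb|j' _].
  - exact: submod0.
  - by rewrite -[a]scale1r; exact: submodP Ba Bb.
  - by rewrite ffunE -(BE (inclP _)) -E_rmul.
have gl : linear (fun y : {ffun J -> sub B} => mksub (fB y)).
  move=> a x y; apply: (@incl_inj _ _ (tens (im u))).
  rewrite (linearP (incl _)) !incl_mksub -(linmapE (tens_map_linear f)).
  rewrite -(linmapE (tens_map_linear f)) -[in RHS](linmapE (tens_map_linear f)).
  rewrite -linearP; congr (linmap _ _); apply/ffunP => i; rewrite !ffunE.
  exact: (linearP (incl B)).
have hl : linear (fun y : sub (tens (im j)) =>
    [ffun i => mksub ((inclP y).1 i)] : {ffun J -> sub B}).
  move=> a x y; apply/ffunP => i; apply: (@incl_inj _ _ B).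
  rewrite ffunZD (linearP (incl B)) !ffunE !incl_mksub.
  by rewrite (linearP (incl (tens (im j)))) ffunZD.
apply: (fin_res_quot (f := linmap hl) (g := linmap gl)); first split.
- move=> x y /ffunP exy; apply: (@incl_inj _ _ (tens (im j))); apply/ffunP => i.
  by have /(congr1 (incl _)) := exy i; rewrite !ffunE !incl_mksub.
- move=> x.
  (* The lifting need not have its entries in B; the projector E repairs this,
     as it commutes with f and fixes x. *)
  have [|y yP] := @tens_map_lift _ _ f (incl _ x).
    move=> w; have [v uv] := (inclP x).2 w.
    by have [z pz] := psurj v; exists z; rewrite lcompE pz.
  exists [ffun i => mksub (EB (y i))]; apply: (@incl_inj _ _ (tens (im u))).
  rewrite linmapE incl_mksub; apply/ffunP => i; rewrite ffunE.
  rewrite -[RHS]BE; last exact: (inclP x).1.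
  rewrite -yP ffunE -[RHS]/(addmap ED _) raddf_sum; apply: eq_bigr => l _.
  by rewrite -[RHS]/(E _) E_rmul !ffunE incl_mksub.
- move=> y; rewrite linmapE; split.
    move/(congr1 (incl _)); rewrite incl_mksub raddf0 => y0.
    have yj : tens (im j) [ffun i => incl B (y i)].
      split=> [i|w]; first by rewrite ffunE; exact: inclP.
      apply/jp; apply: uinj; rewrite -lcompE -slices_tens_map y0 raddf0.
      by apply/ffunP => i; rewrite !ffunE raddf0.
    exists (mksub yj); apply/ffunP => i; apply: (@incl_inj _ _ B).
    by rewrite !ffunE !incl_mksub ffunE.
  move=> [x <-]; apply: (@incl_inj _ _ (tens (im u))).
  have ex : [ffun l => incl B (linmap hl x l)] = incl _ x.
    by apply/ffunP => l; rewrite ffunE linmapE ffunE incl_mksub.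
  rewrite incl_mksub raddf0 ex; apply/ffunP => i; rewrite [RHS]ffunE.
  apply: (slice_eq0 (r := r)) => w.
  have s0 : slices w (tens_map f (incl _ x)) = 0.
    rewrite slices_tens_map lcompE.
    have /jp -> : exists z, j z = slices w (incl _ x) := (inclP x).2 w.
    by rewrite raddf0.
  by move/ffunP/(_ i): s0; rewrite [X in X = _ -> _]ffunE [X in _ = X -> _]ffunE.
- exact: IHk (fin_res_le (leqnSn k) Bk).
- exact: fin_res_ffun.
Qed.

(** The fibres of q are the cosets, so that pushing a chain along q adds up the
    coefficients of its slices. *)
Lemma mcoeff_push_quot (Y : choiceType) (q : X -> Y) w x :
  (forall w w', q w = q w' <-> exists h, w' = r w h) ->
  (push q x)@_(q w) = augmentation (slice r w x).
Proof.
move=> qr; move: x; apply: chain_ext => [x y|x y|w'].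
- by rewrite raddfD mcoeffD.
- by rewrite raddfD augmentationD.
rewrite pushU mcoeffU; case: eqP => [/esym/qr[h ->]|qw].
  rewrite (_ : slice r w _ = gelt h) ?[RHS]augmentationU //.
  apply/malgP => k; rewrite mcoeff_slice !mcoeffU.
  by rewrite (inj_eq (ract_inj (f := r) (x := w))).
rewrite (_ : slice r w _ = 0) ?augmentation0 //.
apply/malgP => k; rewrite mcoeff_slice mcoeffU mcoeff0.
by case: eqP => // w'E; case: qw; apply/esym/qr; exists k.
Qed.

Lemma push_quot_eq0 (Y : choiceType) (q : X -> Y) x :
  (forall w w', q w = q w' <-> exists h, w' = r w h) ->
  push q x = 0 <-> forall w, augmentation (slice r w x) = 0.
Proof.
move=> qr; split=> [x0 w|x0].
  by rewrite -(mcoeff_push_quot _ _ qr) x0 mcoeff0.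
apply/malgP => y; rewrite mcoeff0.
have [[w <-]|yN] := pselect (exists w, q w = y).
  by rewrite (mcoeff_push_quot _ _ qr).
by apply: mcoeff_push_out => w qw; apply: yN; exists w.
Qed.

End InducedModules.

(** The augmentation with a free module of rank 1 in the form used by
    [fin_res]; its kernel is the augmentation ideal. *)
Definition aug (H : groupType) :
    {linear {ffun unit -> (group_ring H)^o} -> triv_module H} :=
  from_free (fun _ : unit => (1 : int) : triv_module H).

Lemma augE (H : groupType) v : aug H v = augmentation (v tt).
Proof.
rewrite /aug /from_free linmapE (bigD1 tt) //= big1 ?addr0; last by case.
by rewrite -[_ *: _]/(triv_scale _ _) /triv_scale mulr1.
Qed.

(** The augmentation ideal is the first syzygy of the trivial module. *)
Lemma aug_ker_fin_res (H : groupType) k :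
  type_FP k H -> fin_res k (sub (ker (aug H))).
Proof.
move=> [P [d [e [Pres Pfg]]]]; apply: fin_res_ker.
  by move=> c; exists [ffun _ => << c *g 1%g >>]; rewrite augE ffunE augmentationU.
by apply: (fin_res_resolution Pres) => n; exact: Pfg.
Qed.

(** The case of [tens_fin_res] where K is the augmentation ideal of H: by
    flatness, B (x) K is the kernel of B -> B (x) Z. *)
Lemma tens_aug_fin_res (G H : groupType) (X Y : choiceType) (to : gset G X)
    (r : free_ract H X) (q : X -> Y) (B C : submodule (permod to))
    (E : {malg int[X]} -> {malg int[X]}) k :
  (forall g w h, to g (r w h) = r (to g w) h) ->
  {morph E : x y / x + y} -> (forall x, B (E x)) -> (forall x, B x -> E x = x) ->
  (forall x h, E (push (r^~ h) x) = push (r^~ h) (E x)) ->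
  (forall w w', q w = q w' <-> exists h, w' = r w h) ->
  (forall x, C x <-> B x /\ push q x = 0) ->
  type_FP k H -> fin_res k (sub B) -> fin_res k (sub C).
Proof.
move=> tor ED EB BE Er qr CE Hk Bk.
pose T := tens tor B (im (incl (ker (aug H)))).
have T_k : fin_res k (sub T).
  apply: (tens_fin_res tor ED EB BE Er) => //; first exact: incl_inj.
  exact: aug_ker_fin_res.
have imker v : im (incl (ker (aug H))) v <-> aug H v = 0.
  split=> [[y <-]|v0]; first exact: (inclP (S := ker (aug H))).
  by exists (mksub (S := ker (aug H)) v0); rewrite incl_mksub.
have TC (x : sub T) : C (incl T x tt).
  have [Bx Sx] := inclP x; apply/CE; split=> //.
  apply/(push_quot_eq0 _ qr) => w.
  by have /imker := Sx w; rewrite augE ffunE.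
have fl : linear (fun x : sub T => mksub (TC x)).
  move=> a x y; apply: (@incl_inj _ _ C).
  by rewrite (linearP (incl C)) !incl_mksub (linearP (incl T)) ffunZD.
apply: (fin_res_iso (f := linmap fl)) => //.
  move=> x y /(congr1 (incl _)); rewrite !incl_mksub => exy.
  by apply: (@incl_inj _ _ T); apply/ffunP => -[].
move=> x; have [Bx qx] := (CE _).1 (inclP x).
have xT : T [ffun _ => incl C x].
  split=> [i|w]; first by rewrite ffunE.
  apply/imker; rewrite augE !ffunE.
  exact: ((push_quot_eq0 _ qr).1 qx w).
exists (mksub xT); apply: (@incl_inj _ _ C).
by rewrite incl_mksub incl_mksub ffunE.
Qed.

(** * Permutation modules of orbits *)

Lemma push_linear (G : groupType) (X Y : choiceType) (tX : gset G X)
    (tY : gset G Y) (f : X -> Y) :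
  (forall g x, f (tX g x) = tY g (f x)) ->
  linear (push f : permod tX -> permod tY).
Proof.
move=> fg; apply: gelt_linear => [x y|g x]; first exact: raddfD.
by rewrite !gelt_permod !push_comp; apply: eq_push => w /=.
Qed.

Section Restriction.
Context (K : choiceType).
Implicit Types (P Q : pred K) (x : {malg int[K]}).

Definition restr P x : {malg int[K]} := [malg k in msupp x => if P k then x@_k else 0].

Lemma mcoeff_restr P x k : (restr P x)@_k = if P k then x@_k else 0.
Proof.
by rewrite mcoeffE; case: ifPn => // /mcoeff_outdom ->; case: ifP.
Qed.

Lemma restrD P : {morph restr P : x y / x + y}.
Proof.
move=> x y; apply/malgP => k; rewrite mcoeffD !mcoeff_restr mcoeffD.
by case: ifP; rewrite ?addr0.
Qed.

HB.instance Definition _ P := GRing.isNmodMorphism.Build {malg int[K]} {malg int[K]}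
  (restr P) (addmap0 (@restrD P), @restrD P).

#[global] Opaque restr.

Lemma restr_msupp P x k : restr P x = x -> k \in msupp x -> P k.
Proof.
move=> <-; rewrite -mcoeff_neq0 mcoeff_restr.
by case: (P k) => //; rewrite eqxx.
Qed.

Lemma restrU P k : restr P << k >> = if P k then << k >> else 0.
Proof.
apply/malgP => l; rewrite mcoeff_restr.
by case: ifPn => Pl; case: ifPn => Pk; rewrite ?mcoeff0 // mcoeffU;
  case: eqP => // kl; rewrite -kl ?(negbTE Pk) ?Pk in Pl.
Qed.

End Restriction.

Lemma restr_push (K L : choiceType) (P : pred K) (Q : pred L) (f : K -> L) x :
  (forall k, Q (f k) = P k) -> restr Q (push f x) = push f (restr P x).
Proof.
move=> QP; move: x; apply: chain_ext => [x y|x y|k].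
- by rewrite !raddfD.
- by rewrite !raddfD.
by rewrite pushU !restrU QP; case: ifP => _; rewrite ?raddf0 ?pushU.
Qed.

(** The stabilizer enters through an injective morphism phi, so that it may be
    a group given independently of the group that acts. *)
Section Orbit.
Context (G L : groupType) (X : choiceType) (to : gset G X) (w0 : X) (phi : L -> G).
Context (phiM : {morph phi : x y / (x * y)%g}).
Context (phi_inj : injective phi).
Context (stabE : forall g, to g w0 = w0 <-> exists l, phi l = g).

Definition regular : gset G G := GSet (@mul1g G) (fun g h k => esym (mulgA g h k)).

Fact phi1 : phi 1%g = 1%g.
Proof. by apply: (mulgI (phi 1%g)); rewrite -phiM !mulg1. Qed.

Definition translate : free_ract L G.
Proof.
exists (fun g l => (g * phi l)%g) => [g|g l k|g l k].
- by rewrite phi1 mulg1.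
- by rewrite phiM mulgA.
- by move/mulgI/phi_inj.
Defined.

Lemma regular_fin_res k : fin_res k (permod regular).
Proof.
pose f := from_free (fun _ : unit => << 1%g >> : permod regular).
have fE v : f v = v tt.
  rewrite /f /from_free linmapE (bigD1 tt) //= big1 ?addr0; last by case.
  move: (v tt); apply: group_ring_ext => [x y|//|g]; first by rewrite scalerDl.
  by rewrite gelt_permod pushU /= mulg1.
apply: (fin_res_iso (f := f)); last exact: fin_res_free.
  by move=> v w; rewrite !fE => vw; apply/ffunP => -[].
by move=> x; exists [ffun _ => x]; rewrite fE ffunE.
Qed.

Definition in_orbit : pred X := fun w => `[< exists g, w = to g w0 >].

(** The module of the orbit is the quotient of the regular module by the kernel
    of g |-> g w0. As L acts on the right on G with the fibres of this map as
    its orbits, the kernel is the tensor product of the regular module with the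
    augmentation ideal of L. *)
Lemma orbit_fin_res k (C : submodule (permod to)) :
  (forall x, C x <-> restr in_orbit x = x) ->
  type_FP k L -> fin_res k.+1 (sub C).
Proof.
move=> CE Lk; pose q (g : G) := to g w0.
have ql : linear (push q : permod regular -> permod to).
  by apply: push_linear => g h; rewrite /q /= gactM.
have qC x : C (linmap ql x).
  apply/CE; rewrite linmapE (restr_push (P := predT)); last first.
    by move=> g; apply/asboolP; exists g.
  by congr (push q _); apply/malgP => g; rewrite mcoeff_restr.
have fl := @gelt_closed G (permod regular) (fun _ => True) I
  (fun _ _ _ _ => I) (fun _ _ _ => I).
pose full := Submodule (V := permod regular) I fl.
have fullk l : fin_res l (sub full).
  apply: (fin_res_iso (f := corestr (S := full) (f := idfun) (fun _ => I))).
  - by move=> x y /(congr1 (incl _)); rewrite !incl_corestr.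
  - by move=> x; exists (incl _ x); apply: (@incl_inj _ _ full); rewrite incl_corestr.
  - exact: regular_fin_res.
have qr g h : q g = q h <-> exists l, h = translate g l.
  rewrite /q; split=> [gh|[l ->]].
    have /stabE[l lE] : to (g^-1 * h)%g w0 = w0.
      by rewrite gactM -gh -gactM mulVg gact1.
    by exists l; rewrite /= lE mulVKg.
  have /stabE lw : exists l', phi l' = phi l by exists l.
  by rewrite /= gactM lw.
apply: (fin_res_quot (f := incl (ker (linmap ql))) (g := corestr qC)); first split.
- exact: incl_inj.
- move=> x; have /choice[s sP] : forall w, exists g, w \in msupp (incl C x) -> q g = w.
    move=> w; have [wx|] := boolP (w \in msupp (incl C x)); last by exists 1%g.
    have /CE := inclP x => /restr_msupp/(_ wx)/asboolP[g wg].
    by exists g.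
  (* A section s of the orbit map, needed only on the support of the chain. *)
  exists (push s (incl C x)); apply: (@incl_inj _ _ C).
  rewrite incl_corestr linmapE push_comp -[RHS](push_id (f := id)) //.
  by apply: eq_push_in => w wx /=; rewrite sP.
- move=> y; split=> [|[x <-]].
    move/(congr1 (incl _)); rewrite incl_corestr raddf0 => y0.
    by exists (mksub (S := ker _) y0); rewrite incl_mksub.
  apply: (@incl_inj _ _ C); rewrite incl_corestr raddf0.
  exact: (inclP (S := ker (linmap ql))).
- apply: (@tens_aug_fin_res G L G X regular translate q full _ id k) => //.
    by move=> g h l; rewrite /= mulgA.
  by move=> x; split=> [|[]].
- exact: regular_fin_res.
Qed.

End Orbit.

(** * The wreath product acting on decorated tuples *)

#[local] Arguments ds_fun : simpl never.

Section SetCoordinate.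
Context (X : choiceType) (H : groupType).
Implicit Types (a : direct_sum X H) (x y : X) (h : H).

Definition ds_set a x h : direct_sum X H :=
  [fsfun z in (x |` finsupp a)%fset => if z == x then h else a z].

Lemma ds_setE a x h y : ds_set a x h y = if y == x then h else a y.
Proof.
rewrite {1}/ds_fun fsfun_fun !inE; case: eqP => //= _.
by case: ifPn => // /ds_out.
Qed.

Lemma ds_set_id a x : ds_set a x (a x) = a.
Proof. by apply: dsP => y; rewrite ds_setE; case: eqP => // ->. Qed.

Lemma ds_set_set a x h k : ds_set (ds_set a x h) x k = ds_set a x k.
Proof. by apply: dsP => y; rewrite !ds_setE; case: eqP. Qed.

Lemma ds_setC a x y h k : x != y ->
  ds_set (ds_set a x h) y k = ds_set (ds_set a y k) x h.
Proof.
move=> xy; apply: dsP => z; rewrite !ds_setE.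
by case: (eqVneq z y) => // ->; rewrite eq_sym (negbTE xy).
Qed.

End SetCoordinate.

Section WreathChains.
Context (G H : groupType) (X : choiceType) (to : gset G X).
Notation D := (direct_sum X H).
Notation W := (wreath H to).

(** The set A is W / G, with A acting by translation and G by permuting the
    coordinates. *)
Definition cell (i : nat) : choiceType := (i.-tuple X * D)%type.

Definition cell_act i (g : W) (w : cell i) : cell i :=
  (diagonal to i (sd_right g) w.1,
   (sd_left g * ds_perm to (sd_right g) w.2)%g).

Fact cell_act1 i w : @cell_act i 1%g w = w.
Proof.
by case: w => t a; rewrite /cell_act gact1 /= ds_perm1 mul1g.
Qed.

Fact cell_actM i (g h : W) w : @cell_act i (g * h)%g w = cell_act g (cell_act h w).
Proof.
case: w g h => t a [b g] [c h]; rewrite /cell_act /= diag_actM.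
by rewrite ds_permM ds_perm_morph mulgA.
Qed.

Definition cells i : gset W (cell i) := GSet (@cell_act1 i) (@cell_actM i).

Section Coordinate.
Context (i : nat) (l : 'I_i).

(** The right action of H on the coordinate of A that the tuple singles out.
    Since the coordinate moves along with the tuple, this action commutes with
    the whole wreath product. *)
Definition coord_mul (w : cell i) (h : H) : cell i :=
  (w.1, ds_set w.2 (tnth w.1 l) (ds_fun w.2 (tnth w.1 l) * h)%g).

(** The quotient by this right action, realized inside the same set. *)
Definition kill (w : cell i) : cell i := (w.1, ds_set w.2 (tnth w.1 l) 1%g).

Fact coord_mul1 w : coord_mul w 1%g = w.
Proof. by case: w => t a; rewrite /coord_mul /= mulg1 ds_set_id. Qed.

Fact coord_mulM w h k : coord_mul w (h * k)%g = coord_mul (coord_mul w h) k.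
Proof. by rewrite /coord_mul /= ds_setE eqxx ds_set_set mulgA. Qed.

Fact coord_mul_inj w : injective (coord_mul w).
Proof.
move=> h k [] /(congr1 (fun a : D => a (tnth w.1 l))).
by rewrite /= !ds_setE eqxx => /mulgI.
Qed.

Definition coord_ract : free_ract H (cell i) :=
  FreeRact coord_mul1 coord_mulM coord_mul_inj.

Lemma to_coord_ract g w h :
  cells i g (coord_ract w h) = coord_ract (cells i g w) h.
Proof.
case: w g => t a [b g]; congr (_, _); apply: dsP => x /=.
have gV y : (to g^-1%g x == y) = (x == to g y).
  by apply/eqP/eqP => [<-|->]; rewrite -gactM ?mulgV ?mulVg gact1.
rewrite !(ds_mulE, ds_permE, ds_setE) tnth_mktuple gV.
case: eqP => [->|_] //.
by rewrite -gactM mulVg gact1 mulgA.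
Qed.

Lemma kill_quot w w' : kill w = kill w' <-> exists h, w' = coord_ract w h.
Proof.
case: w w' => t a [t' a']; rewrite /kill /= /coord_mul /=; split=> [[<- aa']|[h [-> ->]]].
  exists ((a (tnth t l))^-1 * a' (tnth t l))%g; congr (_, _); apply: dsP => x.
  rewrite ds_setE mulVKg; case: eqP => [->//|/eqP xl].
  have := congr1 (fun c : D => c x) aa'.
  by rewrite /= !ds_setE (negbTE xl).
by rewrite ds_set_set.
Qed.

End Coordinate.

Lemma kill_idem i (l : 'I_i) w : kill l (kill l w) = kill l w.
Proof. by rewrite /kill /= ds_set_set. Qed.

Lemma killC i (l l' : 'I_i) w : kill l (kill l' w) = kill l' (kill l w).
Proof.
rewrite /kill /=; case: (eqVneq (tnth w.1 l) (tnth w.1 l')) => [->//|ll'].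
by rewrite ds_setC // eq_sym.
Qed.

(** Two entries with different values act on different coordinates. For equal
    values the statement fails, which is why repeated entries are treated
    separately in [chains_orbit]. *)
Lemma kill_coord_mul i (l l' : 'I_i) w h : tnth w.1 l' != tnth w.1 l ->
  kill l' (coord_mul l w h) = coord_mul l (kill l' w) h.
Proof.
move=> ll'; rewrite /kill /coord_mul /= ds_setE eq_sym (negbTE ll').
by rewrite ds_setC // eq_sym.
Qed.

Lemma kill_cell_act i (l : 'I_i) g w :
  kill l (cells i g w) = kill l (cells i g (kill l w)).
Proof.
have [h ->] : exists h, w = coord_ract l (kill l w) h.
  by apply/kill_quot; rewrite kill_idem.
set v := kill l w; rewrite to_coord_ract.
have -> : kill l (coord_ract l v h) = kill l v by apply/esym/kill_quot; exists h.
rewrite [kill l v]kill_idem -/v.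
by apply/esym/kill_quot; exists h.
Qed.

(** * Chains killed at given entries *)

Section Chains.
Context (i : nat) (P : pred (i.-tuple X)).
Context (Pg : forall g t, P (diagonal to i g t) = P t).
Notation V := (permod (cells i)).
Notation on P := (fun w : cell i => P w.1).

(** The predicate P restricts the tuples, in practice to one orbit, and s lists
    the entries for which the condition is imposed so far. *)
Definition chain_mem (s : seq 'I_i) (x : V) : Prop :=
  restr (on P) x = x /\ forall l, l \in s -> push (kill l) x = 0.

Fact chain_mem0 s : chain_mem s 0.
Proof. by split=> *; rewrite raddf0. Qed.

Lemma restr_gelt g (x : V) : restr (on P) (gelt g *: x) = gelt g *: (restr (on P) x : V).
Proof. by rewrite !gelt_permod; apply: restr_push => w; exact: Pg. Qed.

Lemma push_kill_gelt l g (x : V) :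
  push (kill l) (gelt g *: x) = push (kill l) (gelt g *: (push (kill l) x : V)).
Proof.
rewrite [in LHS]gelt_permod [in RHS]gelt_permod.
rewrite [LHS]push_comp [in RHS]push_comp [RHS]push_comp.
by apply: eq_push => w /=; exact: kill_cell_act.
Qed.

Fact chain_closed s : forall a x y,
  chain_mem s x -> chain_mem s y -> chain_mem s (a *: x + y).
Proof.
apply: gelt_closed => [|x y [Px Kx] [Py Ky]|g x [Px Kx]].
- exact: chain_mem0.
- split=> [|l ls]; first by rewrite raddfB /= Px Py.
  by rewrite raddfB /= Kx // Ky // subrr.
- split=> [|l ls]; first by rewrite restr_gelt Px.
  by rewrite push_kill_gelt Kx // scaler0 raddf0.
Qed.

Definition chains s : submodule V := Submodule (chain_mem0 s) (chain_closed (s := s)).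

(** The product of the idempotents 1 - p_l, composed with the restriction. *)
Fixpoint proj (s : seq 'I_i) (x : {malg int[cell i]}) : {malg int[cell i]} :=
  if s is l :: s' then proj s' x - push (kill l) (proj s' x) else restr (on P) x.

Lemma projD s : {morph proj s : x y / x + y}.
Proof.
elim: s => [|l s IHs] x y; first exact: raddfD.
by rewrite /= IHs raddfD /= opprD addrACA.
Qed.

Lemma proj_chain s x : chains s (proj s x).
Proof.
have rk l y : restr (on P) (push (kill l) y) = push (kill l) (restr (on P) y).
  exact: restr_push.
elim: s => [|l s [Pp Kp]]; split=> //=.
- by apply/malgP => w; rewrite !mcoeff_restr; case: (P w.1).
- by rewrite raddfB /= rk Pp.
move=> l'; rewrite inE raddfB /= push_comp => /predU1P[->|l's].
  by rewrite (eq_push (g := kill l)) ?subrr // => w; exact: kill_idem.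
rewrite (eq_push (f := kill l' \o kill l) (g := kill l \o kill l')) => [|w].
  2: by rewrite /= killC.
by rewrite -push_comp Kp // raddf0 subrr.
Qed.

Lemma chain_proj s x : chains s x -> proj s x = x.
Proof.
elim: s => [|l s IHs] [Px Kx] //=.
rewrite IHs ?Kx ?subr0 ?mem_head //; split=> // l' l's.
by apply: Kx; rewrite inE l's orbT.
Qed.

Lemma proj_coord_mul s l x h :
  (forall t l', P t -> l' \in s -> tnth t l' != tnth t l) ->
  proj s (push (fun w => coord_mul l w h) x) = push (fun w => coord_mul l w h) (proj s x).
Proof.
elim: s => [|l' s IHs] ls /=; first exact: restr_push.
rewrite IHs => [|t l'' Pt l''s]; last by apply: ls; rewrite // inE l''s orbT.
have -> : push (kill l') (push (fun w => coord_mul l w h) (proj s x)) =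
    push (fun w => coord_mul l w h) (push (kill l') (proj s x)); last first.
  by rewrite (raddfB (push _)).
rewrite [LHS]push_comp [RHS]push_comp; apply: eq_push_in => w wx /=.
apply: kill_coord_mul; apply: ls; rewrite ?mem_head //.
exact: restr_msupp (proj_chain s x).1 wx.
Qed.

(** Imposing the condition at l tensors with the augmentation ideal of H. *)
Lemma chains_step k s l : type_FP k H ->
  (forall t l', P t -> l' \in s -> tnth t l' != tnth t l) ->
  fin_res k (sub (chains s)) -> fin_res k (sub (chains (l :: s))).
Proof.
move=> Hk ls; apply: (tens_aug_fin_res (r := coord_ract l) (q := kill l)
  (E := proj s)) => //.
- exact: to_coord_ract.
- exact: projD.
- exact: proj_chain.
- exact: chain_proj.
- by move=> x h; exact: proj_coord_mul.
- exact: kill_quot.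
move=> x; split=> [[Px Kx]|[[Px Kx] K0]].
  split; last by apply: Kx; rewrite mem_head.
  by split=> // l' l's; apply: Kx; rewrite inE l's orbT.
split; first exact: Px.
move=> l'; rewrite in_cons => /predU1P[->|l's]; first exact: K0.
exact: Kx.
Qed.

End Chains.

Section Orbits.
Context (i : nat).
Implicit Types (t : i.-tuple X) (s : seq 'I_i) (P Q : pred (i.-tuple X)).

Definition orbit_of t0 : pred (i.-tuple X) :=
  fun t => `[< exists g, t = diagonal to i g t0 >].

Lemma orbit_of_act t0 g t : orbit_of t0 (diagonal to i g t) = orbit_of t0 t.
Proof.
apply: asbool_equiv_eq; split=> [[h gh]|[h ->]]; last first.
  by exists (g * h)%g; rewrite gactM.
by exists (g^-1 * h)%g; rewrite gactM -gh -gactM mulVg gact1.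
Qed.

(** Conditions are imposed one entry after the other. On an orbit all tuples
    have the same pattern of equal entries, so either the new condition follows
    from an earlier one on the whole orbit, or [chains_step] applies. *)
Lemma chains_orbit (L : groupType) (iota : L -> G) t0 s k :
  {morph iota : x y / (x * y)%g} -> injective iota ->
  (forall g, diagonal to i g t0 = t0 <-> exists l, iota l = g) ->
  type_FP k L -> (s != [::] -> type_FP k.+1 H) ->
  fin_res k.+1 (sub (chains (orbit_of_act t0) s)).
Proof.
move=> iM iI stab Lk Hk; elim: s Hk => [_|l s IHs Hk].
  pose w0 : cell i := (t0, 1%g : D).
  pose phi (l : L) : W := SDProd (ds_autact H to) 1%g (iota l).
  have ds1 g : ds_perm (H := H) to g 1%g = 1%g.
    exact: (autact1 (ds_autact H to)).
  apply: (@orbit_fin_res W L (cell i) (cells i) w0 phi) => //.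
  - by move=> x y; rewrite /phi iM; congr SDProd; rewrite /= ds1 mulg1.
  - by move=> x y [] /iI.
  - case=> a g; split=> [[] gt a1|[l [<- <-]]].
      have /stab[l <-] := gt; exists l; congr SDProd.
      by rewrite -[LHS]a1 /= ds1 mulg1.
    rewrite /= /cell_act /= ds1 mulg1 /w0; congr (_, _).
    by apply/stab; exists l.
  move=> x; rewrite (_ : in_orbit _ _ = (fun w => orbit_of t0 w.1)).
    by split=> [[]//|xr]; split.
  apply/funext => -[t a]; apply: asbool_equiv_eq; split=> [[[b g] [-> _]]|[g /= ->]].
    by exists g.
  exists (SDProd (ds_autact H to) a g); rewrite /= /cell_act /= ds1.
  by congr (_, _); rewrite mulg1.
have {}IHs : fin_res k.+1 (sub (chains (orbit_of_act t0) s)).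
  by apply: IHs => _; exact: Hk.
have tnth_orbit_of t l1 l2 : orbit_of t0 t ->
    (tnth t l1 == tnth t l2) = (tnth t0 l1 == tnth t0 l2).
  move=> /asboolP[g ->]; rewrite !tnth_mktuple; apply/eqP/eqP => [|->//].
  by move/(congr1 (to g^-1%g)); rewrite -!gactM mulVg !gact1.
have [/hasP[l' l's /eqP tl]|/hasPn lN] :=
    boolP (has (fun l' => tnth t0 l' == tnth t0 l) s).
  apply: (fin_res_sub_eq _ IHs) => x.
  split=> [[Px Kx]|[Px Kx]]; split; try exact: Px; last first.
    by move=> l1 l1s; apply: Kx; rewrite in_cons l1s orbT.
  move=> l1; rewrite in_cons => /predU1P[->|l1s]; last exact: Kx.
  rewrite -(Kx l' l's); apply: eq_push_in => w wx.
  have := restr_msupp Px wx => /(tnth_orbit_of _ l' l); rewrite tl eqxx => /eqP wl.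
  by rewrite /kill wl.
apply: chains_step => //; first exact: Hk.
by move=> t l' tP l's; rewrite tnth_orbit_of //; exact: lN.
Qed.

(** Restriction to Q splits the sum over a disjoint union. *)
Lemma chains_union P Q s k
    (Pg : forall g t, P (diagonal to i g t) = P t)
    (Qg : forall g t, Q (diagonal to i g t) = Q t)
    (PQg : forall g t, (P (diagonal to i g t) || Q (diagonal to i g t)) = P t || Q t) :
  (forall t, ~~ (P t && Q t)) ->
  fin_res k (sub (chains Pg s)) -> fin_res k (sub (chains Qg s)) ->
  fin_res k (sub (chains (P := fun t => P t || Q t) PQg s)).
Proof.
move=> PQ Pk Qk; pose U := chains (P := fun t => P t || Q t) PQg s.
have fU (x : sub (chains Pg s)) : U (incl _ x).
  have [Px Kx] := inclP x; split; last exact: Kx.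
  apply/malgP => w; rewrite mcoeff_restr -Px mcoeff_restr.
  by case: (P w.1); case: (Q w.1).
have gl : linear (restr (fun w : cell i => Q w.1) : permod (cells i) -> permod (cells i)).
  by apply: gelt_linear => [x y|g x]; [exact: raddfD | exact: restr_gelt].
have gQ (x : sub U) : chains Qg s (lcomp (linmap gl) (incl U) x).
  have [Ux Kx] := inclP x; rewrite lcompE linmapE; split.
    by apply/malgP => w; rewrite !mcoeff_restr; case: (Q w.1).
  move=> l ls; rewrite -(restr_push (Q := fun w : cell i => Q w.1)) //.
  by rewrite Kx // raddf0.
apply: (fin_res_ext (f := corestr fU) (g := corestr gQ)) => //; split.
- by move=> x y /(congr1 (incl _)); rewrite !incl_corestr => /incl_inj.
- move=> y; have [Qy Ky] := inclP y.
  have Uy : U (incl _ y).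
    split; last exact: Ky.
    apply/malgP => w; rewrite mcoeff_restr -Qy mcoeff_restr.
    by case: (P w.1); case: (Q w.1).
  exists (mksub Uy); apply: (@incl_inj _ _ (chains Qg s)).
  by rewrite incl_corestr lcompE linmapE incl_mksub.
- move=> x; have [Ux Kx] := inclP x; split=> [|[y <-]].
    move/(congr1 (incl _)); rewrite incl_corestr lcompE linmapE raddf0 => Qx.
    have Px : chains Pg s (incl _ x).
      split; last exact: Kx.
      apply/malgP => w; rewrite mcoeff_restr -{2}Ux mcoeff_restr.
      have /malgP/(_ w) := Qx; rewrite mcoeff_restr mcoeff0.
      by case: (P w.1); case: (Q w.1).
    by exists (mksub Px); apply: (@incl_inj _ _ U); rewrite incl_corestr incl_mksub.
  apply: (@incl_inj _ _ (chains Qg s)); rewrite incl_corestr lcompE linmapE.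
  rewrite incl_corestr raddf0; have [Py _] := inclP y.
  apply/malgP => w; rewrite mcoeff_restr -Py mcoeff_restr mcoeff0.
  by have := PQ w.1; case: (P w.1); case: (Q w.1).
Qed.

Fact predT_act g t : predT (diagonal to i g t) = predT t. Proof. by []. Qed.

Lemma chains_orbits s k : finitely_many_orbits (diagonal to i) ->
  (forall t0, fin_res k (sub (chains (orbit_of_act t0) s))) ->
  fin_res k (sub (chains predT_act s)).
Proof.
move=> fin orbk; have [ts tsP] : exists ts, forall t, has (orbit_of^~ t) ts.
  have /finite_seqP[os osE] := fin.
  have osP O : O \in os -> exists t, gorbit (diagonal to i) t = O.
    move=> Os; have : [set` os]%classic O by [].
    by rewrite -osE => -[t _ <-]; exists t.
  have rangeP t : gorbit (diagonal to i) t \in os.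
    have : range (gorbit (diagonal to i)) (gorbit (diagonal to i) t) by exists t.
    by rewrite osE.
  have [ts tsP] : exists ts : seq (i.-tuple X), forall O, O \in os ->
      exists2 t, t \in ts & gorbit (diagonal to i) t = O.
    elim: os osP {osE rangeP} => [|O os IHos] osP; first by exists [::].
    have [t tO] := osP O (mem_head _ _).
    have [|ts tsP] := IHos; first by move=> O' O's; apply: osP; rewrite in_cons O's orbT.
    exists (t :: ts) => O'; rewrite in_cons => /predU1P[->|/tsP[t' t's tO']].
      by exists t; rewrite ?mem_head.
    by exists t'; rewrite // in_cons t's orbT.
  exists ts => t.
  have /tsP[t0 t0s tt0] := rangeP t; apply/hasP; exists t0 => //; apply/asboolP.
  have : gorbit (diagonal to i) t t by exists 1%g; rewrite // gact1.
  by rewrite -tt0 => -[g _ <-]; exists g.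
pose P ts t := has (orbit_of^~ t) ts.
have Pg ts' g t : P ts' (diagonal to i g t) = P ts' t.
  by apply: eq_has => t0; exact: orbit_of_act.
suff Pk ts' : fin_res k (sub (chains (Pg ts') s)).
  apply: (fin_res_sub_eq _ (Pk ts)) => x.
  split=> -[Px Kx]; split=> //.
    by apply/malgP => w; rewrite mcoeff_restr.
  by apply/malgP => w; rewrite mcoeff_restr /P tsP.
elim: ts' => [|t0 ts' IH].
  apply: fin_res0 => x; apply: (@incl_inj _ _ (chains (Pg [::]) s)).
  have [<- _] := inclP x; rewrite raddf0.
  by apply/malgP => w; rewrite mcoeff_restr mcoeff0.
have orbP t : P ts' t0 -> orbit_of t0 t -> P ts' t.
  move=> /hasP[t1 t1s /asboolP[g ->]] /asboolP[h ->].
  by apply/hasP; exists t1 => //; apply/asboolP; exists (h * g)%g; rewrite gactM.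
have [Pt0|Pt0] := boolP (P ts' t0).
  apply: (fin_res_sub_eq _ IH) => x.
  have PE : restr (fun w : cell i => P (t0 :: ts') w.1) x =
      restr (fun w : cell i => P ts' w.1) x.
    apply/malgP => w; rewrite !mcoeff_restr.
    have -> // : P (t0 :: ts') w.1 = P ts' w.1.
    rewrite /P /=; case: (boolP (orbit_of t0 w.1)) => //= o.
    by apply/esym/orbP.
  by split=> -[Px Kx]; split; rewrite // ?PE // -PE.
apply: (@chains_union (orbit_of t0) (P ts') s k (orbit_of_act t0) (Pg ts')
  (Pg (t0 :: ts')) _ (orbk t0) IH) => t; apply: contraNN Pt0 => /andP[/asboolP[g ->]].
by rewrite (Pg ts').
Qed.

End Orbits.

(** * Exactness of the complex of killed chains *)

Definition del i (j : 'I_i.+1) (w : cell i.+1) : cell i :=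
  ([tuple tnth w.1 (lift j l) | l < i], w.2).

Definition cons_cell i (y : X) (w : cell i) : cell i.+1 := ([tuple of y :: w.1], w.2).

Definition clear i (y : X) (w : cell i) : cell i := (w.1, ds_set w.2 y 1%g).

Definition boundary i (x : {malg int[cell i.+1]}) : {malg int[cell i]} :=
  \sum_(j < i.+1) push (del j) x *~ (-1) ^+ j.

Lemma boundaryD i : {morph @boundary i : x y / x + y}.
Proof.
move=> x y; rewrite /boundary -big_split; apply: eq_bigr => j _.
by rewrite raddfD mulrzDl.
Qed.

HB.instance Definition _ i := GRing.isNmodMorphism.Build {malg int[cell i.+1]}
  {malg int[cell i]} (@boundary i) (addmap0 (@boundaryD i), @boundaryD i).

Lemma push_boundary i (K : choiceType) (f : cell i -> K) (x : {malg int[cell i.+1]}) :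
  push f (boundary x) = \sum_(j < i.+1) push (f \o del j) x *~ (-1) ^+ j.
Proof.
by rewrite raddf_sum; apply: eq_bigr => j _; rewrite raddfMz /= push_comp.
Qed.

Lemma del0_cons i y (w : cell i) : del ord0 (cons_cell y w) = w.
Proof.
case: w => t a; congr (_, _); apply: eq_from_tnth => l.
by rewrite tnth_mktuple /= (tnth_nth y) /= (tnth_nth y).
Qed.

Lemma delS_cons i y (j : 'I_i.+1) (w : cell i.+1) :
  del (lift ord0 j) (cons_cell y w) = cons_cell y (del j w).
Proof.
case: w => t a; congr (_, _); apply: eq_from_tnth => l; rewrite tnth_mktuple.
case: (unliftP ord0 l) => [l' ->|->] /=.
  rewrite [LHS](tnth_nth y) [RHS]tnthS tnth_mktuple [RHS](tnth_nth y) /=.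
  by rewrite /bump /= !add1n ltnS addnS.
have -> : lift (lift ord0 j) ord0 = ord0 by exact: val_inj.
by rewrite !tnth0.
Qed.

Lemma boundary_cons0 y (x : {malg int[cell 0]}) : boundary (push (@cons_cell 0 y) x) = x.
Proof.
rewrite /boundary big_ord1 expr0 push_comp push_id // => w.
exact: del0_cons.
Qed.

(** Coning: adding y in front is a contracting homotopy of the whole complex,
    before the submodules J_t are taken into account. *)
Lemma boundary_consS i y (x : {malg int[cell i.+1]}) :
  boundary (push (@cons_cell _ y) x) = x - push (@cons_cell _ y) (boundary x).
Proof.
rewrite [LHS]big_ord_recl [X in X + _]mulr1z.
rewrite [X in X + _]push_comp [X in X + _]push_id; last exact: del0_cons.
congr (_ + _); rewrite push_boundary -sumrN; apply: eq_bigr => j _.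
have -> : (-1) ^+ lift ord0 j = - (-1) ^+ j :> int by rewrite lift0 exprS mulN1r.
rewrite mulrNz [push _ (push _ _)]push_comp.
by rewrite (eq_push (g := cons_cell y \o del j)) // => w; exact: delS_cons.
Qed.

Lemma cell_cons i (w : cell i.+1) : exists y w', w = @cons_cell i y w'.
Proof.
case: w => t a; exists (thead t), ([tuple of behead t], a).
by rewrite {1}[t]tuple_eta.
Qed.

(** Every tuple of positive length is a cone, so that the homotopy formula
    reduces the claim for a tuple to the claim for a shorter one. *)
Lemma boundary_boundary i (x : {malg int[cell i.+2]}) : boundary (boundary x) = 0.
Proof.
elim: i x => [|i IHi] x; move: x; apply: chain_ext => [x y|x y|w];
  rewrite ?raddfD ?addr0 //.
  have [y [w' ->]] := cell_cons w.
  rewrite -[<< cons_cell y _ >>](pushU (cons_cell y)) boundary_consS raddfB /=.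
  by rewrite boundary_cons0 subrr.
have [y [w' ->]] := cell_cons w.
rewrite -[<< cons_cell y _ >>](pushU (cons_cell y)) boundary_consS raddfB /=.
by rewrite boundary_consS IHi raddf0 subr0 subrr.
Qed.

(** Membership in C_i, the sum of the J_t over the tuples of length i. *)
Definition killed i (x : {malg int[cell i]}) := forall l : 'I_i, push (kill l) x = 0.

Lemma kill_del i (j : 'I_i.+1) l (w : cell i.+1) :
  kill l (del j w) = del j (kill (lift j l) w).
Proof. by rewrite /kill /del /= tnth_mktuple. Qed.

Lemma killed_boundary i (x : {malg int[cell i.+1]}) : killed x -> killed (boundary x).
Proof.
move=> Kx l; rewrite push_boundary big1 // => j _.
rewrite (eq_push (g := del j \o kill (lift j l))); last exact: kill_del.
by rewrite -push_comp Kx raddf0 mul0rz.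
Qed.

Lemma clear_idem i y (w : cell i) : clear y (clear y w) = clear y w.
Proof. by rewrite /clear /= ds_set_set. Qed.

Lemma kill_clear i y l (w : cell i) : kill l (clear y w) = clear y (kill l w).
Proof.
rewrite /kill /clear /=; case: (eqVneq y (tnth w.1 l)) => [->//|yl].
by rewrite ds_setC.
Qed.

Lemma killed_clear i y (x : {malg int[cell i]}) :
  killed x -> killed (push (clear y) x).
Proof.
move=> Kx l; rewrite push_comp (eq_push (g := clear y \o kill l)); last exact: kill_clear.
by rewrite -push_comp Kx raddf0.
Qed.

(** Adding y in front requires one more condition, at the coordinate y. It is
    enforced by the factor 1 - p_y, at the cost that coning no longer contracts
    z but only z - p_y z. *)
Lemma killed_cons i y (x : {malg int[cell i]}) :
  killed x -> killed (push (cons_cell y) (x - push (clear y) x)).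
Proof.
move=> Kx l; case: (unliftP ord0 l) => [l' ->|->].
  rewrite push_comp (eq_push (g := cons_cell y \o kill l')) => [|w]; last first.
    by rewrite /kill /cons_cell /= tnthS.
  by rewrite -push_comp (raddfB (push (kill l'))) /= Kx (killed_clear _ Kx) subrr raddf0.
rewrite push_comp (eq_push (g := cons_cell y \o clear y)) // -push_comp.
rewrite (raddfB (push (clear y))) /= [push (clear y) (push _ _)]push_comp.
rewrite (eq_push (g := clear y)) ?subrr ?raddf0 // => w.
exact: clear_idem.
Qed.

Definition clear_all i (ys : seq X) (w : cell i) : cell i :=
  (w.1, foldl (fun a y => ds_set a y 1%g) w.2 ys).

Lemma clear_allE i ys (w : cell i) z :
  ds_fun (clear_all ys w).2 z = if z \in ys then 1%g else ds_fun w.2 z.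
Proof.
case: w => t a; elim: ys a => //= y ys IHys a; rewrite IHys ds_setE inE.
by case: (z \in ys); rewrite ?orbT ?orbF.
Qed.

(** Telescoping z - p_ys z into the terms u - p_y u, where u is the image of z
    under the resets made before. The predicate Q stands for the condition that
    z is a cycle; in degree 0 it is empty, as [boundary_cons0] has no error
    term. *)
Lemma killed_fill i (Q : {malg int[cell i]} -> Prop) ys x :
  (forall y x, Q x -> Q (push (clear y) x)) ->
  (forall y x, Q x ->
    boundary (push (cons_cell y) (x - push (clear y) x)) = x - push (clear y) x) ->
  killed x -> Q x ->
  exists2 z, killed z & boundary z = x - push (clear_all ys) x.
Proof.
move=> Qclear Qbd; elim: ys x => [|y ys IHys] x Kx Qx.
  by exists 0; [move=> l; rewrite raddf0 | rewrite raddf0 push_id ?subrr // => -[]].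
have [z Kz bz] := IHys _ (killed_clear y Kx) (Qclear y x Qx).
exists (push (cons_cell y) (x - push (clear y) x) + z).
  by move=> l; rewrite raddfD /= (killed_cons y Kx) Kz addr0.
have clearE : clear_all ys \o clear y =1 @clear_all i (y :: ys) by [].
rewrite boundaryD (Qbd y x Qx) bz addrA subrK.
rewrite (push_comp (clear_all ys) (clear y) x).
rewrite (eq_push clearE x); reflexivity.
Qed.

(** Once every first entry of a tuple in the support has been reset, nothing is
    left of z, because z is killed at its first entry. *)
Lemma boundary_exact i (x : {malg int[cell i.+1]}) : killed x -> boundary x = 0 ->
  exists2 z, killed z & boundary z = x.
Proof.
move=> Kx bx; pose ys := [seq thead w.1 | w <- msupp x].
have boundary_clear y (u : {malg int[cell i.+1]}) :
    boundary (push (clear y) u) = push (clear y) (boundary u).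
  rewrite push_boundary; apply: eq_bigr => j _; rewrite push_comp.
  by congr (_ *~ _); apply: eq_push.
have [||z Kz bz] := @killed_fill i.+1 (fun x => boundary x = 0) ys x _ _ Kx bx.
- by move=> y u bu; rewrite boundary_clear bu raddf0.
- move=> y u bu; rewrite boundary_consS raddfB /= boundary_clear bu.
  by rewrite raddf0 subr0 raddf0 subr0.
exists z; rewrite // bz (eq_push_in (g := clear_all ys \o kill ord0)).
  by rewrite -push_comp Kx raddf0 subr0.
move=> w wx /=; congr (_, _); apply: dsP => u.
rewrite -[LHS]/(ds_fun (clear_all ys w).2 u) clear_allE.
rewrite -[RHS]/(ds_fun (clear_all ys (kill ord0 w)).2 u) clear_allE.
case: ifPn => // uN; rewrite ds_setE; case: eqP => // uE.
by case/negP: uN; apply/mapP; exists w; rewrite // uE.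
Qed.

(** On the chains of degree 0 this is the augmentation of the complex. *)
Definition coef_sum (K : choiceType) (x : {malg int[K]}) : int :=
  malg_lift (fun _ => idfun) x.

Lemma coef_sumD (K : choiceType) : {morph @coef_sum K : x y / x + y}.
Proof. exact: malg_liftD. Qed.

HB.instance Definition _ K := GRing.isNmodMorphism.Build {malg int[K]} int
  (@coef_sum K) (addmap0 (@coef_sumD K), @coef_sumD K).

Lemma coef_sumU (K : choiceType) c (w : K) : coef_sum << c *g w >> = c.
Proof. exact: malg_liftU. Qed.

Lemma coef_sum_push (K L : choiceType) (f : K -> L) x : coef_sum (push f x) = coef_sum x.
Proof.
move: x; apply: (chain_ext (f := fun x => coef_sum (push f x))) => [x y|x y|w].
- by rewrite !raddfD.
- by rewrite raddfD.
by rewrite pushU !coef_sumU.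
Qed.

Lemma coef_sum_boundary (x : {malg int[cell 1]}) : killed x -> coef_sum (boundary x) = 0.
Proof.
move=> Kx; rewrite /boundary big_ord1 expr0 mulr1z coef_sum_push.
by rewrite -(coef_sum_push (kill ord0)) Kx raddf0.
Qed.

(** Resetting all the coordinates that occur in the support of z sends every
    element of A in it to 1, so that only the sum of the coefficients is left. *)
Lemma coef_sum_exact (x : {malg int[cell 0]}) : coef_sum x = 0 ->
  exists2 z, killed z & boundary z = x.
Proof.
move=> ex; pose ys := flatten [seq (finsupp w.2 : seq X) | w <- msupp x].
have [|||z Kz bz] := @killed_fill 0 (fun _ => True) ys x _ _ _ I => //.
- by move=> y u _; exact: boundary_cons0.
- by case.
exists z; rewrite // bz (eq_push_in (g := fun=> ([tuple], 1%g : D))).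
  rewrite (_ : push _ x = << coef_sum x *g ([tuple], 1%g : D) >>); last first.
    move: x {ex z Kz bz ys}; apply: chain_ext => [x y|x y|w]; rewrite ?raddfD //.
    by rewrite pushU coef_sumU.
  by rewrite ex monalgU0 subr0.
move=> w wx; rewrite [LHS]surjective_pairing; congr (_, _); first exact: tuple0.
apply: dsP => u; rewrite clear_allE ds_oneE; case: ifPn => // uN.
apply: ds_out; apply: contraNN uN => uw; apply/flattenP.
by exists (finsupp w.2 : seq X); [apply/mapP; exists w | exact: uw].
Qed.

Lemma del_act i j g :
  del j \o cells i.+1 g =1 cells i g \o del j.
Proof. by move=> w; congr (_, _); apply: eq_from_tnth => l; rewrite !tnth_mktuple. Qed.

Lemma boundary_linear i :
  linear (@boundary i : permod (cells i.+1) -> permod (cells i)).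
Proof.
apply: gelt_linear => [x y|g x]; first exact: raddfD.
rewrite [in LHS]gelt_permod [RHS]gelt_permod [RHS]push_boundary.
apply: eq_bigr => j _; rewrite [push _ (push _ _)]push_comp.
by rewrite (eq_push (del_act j g)).
Qed.

Lemma coef_sum_linear :
  linear (@coef_sum _ : permod (cells 0) -> triv_module W).
Proof.
apply: gelt_linear => [x y|g x]; first exact: raddfD.
rewrite gelt_permod coef_sum_push -[RHS]/(triv_scale _ _) /triv_scale.
by rewrite [augmentation _]augmentationU mul1r.
Qed.

Definition killed_chains i : submodule (permod (cells i)) :=
  chains (@predT_act i) (enum 'I_i).

Lemma killed_chainsE i x : killed_chains i x <-> killed x.
Proof.
split=> [[_ Kx] l|Kx]; first by apply: Kx; rewrite mem_enum.
by split=> [|l _]; [apply/malgP => w; rewrite mcoeff_restr | exact: Kx].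
Qed.

Lemma killed_chains_fin_res i k :
  finitely_many_orbits (diagonal to i) ->
  (forall t : i.-tuple X, type_FP k (stabilizer (diagonal to i) t)) ->
  type_FP k.+1 H -> fin_res k.+1 (sub (killed_chains i)).
Proof.
move=> fin stabk Hk; apply: chains_orbits => // t0.
apply: (@chains_orbit i (stabilizer (diagonal to i) t0) val t0) => //.
- exact: val_inj.
- move=> g; split=> [gt|[l <-]]; last exact/eqP/(valP l).
  by exists (Sub g (introT eqP gt) : stabilizer (diagonal to i) t0); rewrite SubK.
Qed.

(** The only tuple of length 0 is stabilized by the whole of G. *)
Lemma killed_chains0_fin_res k : type_FP k G -> fin_res k.+1 (sub (killed_chains 0)).
Proof.
move=> Gk; apply: chains_orbits => [|t0].
  apply: (sub_finite_set _ (finite_set1 (gorbit (diagonal to 0) [tuple]))).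
  by move=> _ [t _ <-]; rewrite (tuple0 t).
apply: (@chains_orbit 0 G id t0) => //.
  by move=> g; split=> [_|_]; [exists g | rewrite [LHS]tuple0 [RHS]tuple0].
by rewrite -size_eq0 size_enum_ord.
Qed.

End WreathChains.

(** * The theorem *)

Lemma type_FP_le k m (G : groupType) : (k <= m)%N -> type_FP m G -> type_FP k G.
Proof.
move=> km [P [d [e [Pres Pfg]]]]; exists P, d, e; split=> // n nk.
exact/Pfg/(leq_trans nk).
Qed.

Close Scope ring_scope.

Theorem proposition4 (m : nat) (G H : groupType) (X : choiceType)
    (to : gset G X)
    (hG : type_FP m G) (hH : type_FP m H)
    (horb : forall i : nat, 1 <= i <= m ->
       finitely_many_orbits (diagonal to i))
    (hstab : forall i : nat, 1 <= i <= m ->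
       forall x : i.-tuple X, type_FP (m - i) (stabilizer (diagonal to i) x)) :
  type_FP m (wreath H to).
Proof.
pose C i := killed_chains H to i.
have dC i (x : sub (C i.+1)) :
    C i (lcomp (linmap (@boundary_linear G H X to i)) (incl _) x).
  apply/killed_chainsE; rewrite lcompE linmapE; apply: killed_boundary.
  exact/killed_chainsE/inclP.
pose d i := corestr (dC i).
pose e := lcomp (linmap (@coef_sum_linear G H X to)) (incl (C 0)).
suff : fin_res m.+1 (triv_module (wreath H to)).
  by move=> /resolution_of_fin_res[P [b [a [Pres Pfg]]]]; exists P, b, a; split.
have killed_in i (x : sub (C i)) : killed (incl _ x).
  exact/killed_chainsE/inclP.
apply: (fin_res_shift (d := d) (e := e)).
- move=> c; have Cc : C 0 (<< c *g ([tuple], 1%g : direct_sum X H) >>)%R.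
    by apply/killed_chainsE; case.
  by exists (mksub Cc); rewrite lcompE linmapE incl_mksub coef_sumU.
- move=> x; rewrite lcompE linmapE; split=> [/coef_sum_exact[z Kz bz]|[z <-]].
    have Cz : C 1 z by apply/killed_chainsE.
    exists (mksub Cz); apply: (@incl_inj _ _ (C 0)).
    by rewrite incl_corestr lcompE linmapE incl_mksub.
  by rewrite incl_corestr lcompE linmapE coef_sum_boundary.
- move=> i x; split=> [|[z <-]].
    move/(congr1 (incl _)); rewrite incl_corestr lcompE linmapE raddf0.
    move/(boundary_exact (killed_in _ x)) => [z Kz bz].
    have Cz : C i.+2 z by apply/killed_chainsE.
    exists (mksub Cz); apply: (@incl_inj _ _ (C i.+1)).
    by rewrite incl_corestr lcompE linmapE incl_mksub.
  apply: (@incl_inj _ _ (C i)); rewrite [RHS]raddf0.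
  rewrite incl_corestr lcompE linmapE incl_corestr lcompE linmapE.
  exact: boundary_boundary.
case=> [_|i im]; first by rewrite subn0; exact: killed_chains0_fin_res.
(* From degree 1 on, m - i + 1 <= m, so that the finiteness of H suffices. *)
rewrite -(subnSK im) subSS; apply: killed_chains_fin_res.
- by apply: horb; rewrite -ltnS.
- by apply: hstab; rewrite -ltnS.
by apply: type_FP_le hH; rewrite subnSK // leq_subr.
Qed.
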